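(* (1) There exists a $(1,1)$-periodic function $Q_1:\mathcal{V}_{\mathrm{hex}}\to\mathbb{R}$ such that $\sigma(\Delta_{\mathrm{hex}}+\lambda Q_1)$ has exactly two connected components for all $\lambda>0$. (2) There exists a $(2,2)$-periodic function $Q_2:\mathcal{V}_{\mathrm{hex}}\to\mathbb{R}$ such that $\sigma(\Delta_{\mathrm{hex}}+\lambda Q_2)$ has exactly four connected components for all sufficiently small $\lambda>0$.
   Context: Hexagonal lattice: let $\bm{a}_1=(1,0)$ and $\bm{b}_\pm=\frac12(3,\pm\sqrt3)$ in $\mathbb{R}^2$, and let $\mathcal{V}_{\mathrm{hex}}=\{n\bm{b}_++m\bm{b}_-:n,m\in\mathbb{Z}\}\cup\{\bm{a}_1+n\bm{b}_++m\bm{b}_-:n,m\in\mathbb{Z}\}$; vertices $u,v$ are neighbors, $u\sim v$, iff their Euclidean distance is $1$ (so each vertex has three neighbors). The Laplacian $\Delta_{\mathrm{hex}}$ is the bounded self-adjoint operator on $\ell^2(\mathcal{V}_{\mathrm{hex}})$ given by $[\Delta_{\mathrm{hex}}\psi]_u=\sum_{v\sim u}\psi_v$ (the adjacency operator). A bounded function $Q:\mathcal{V}_{\mathrm{hex}}\to\mathbb{R}$ acts by multiplication, $[Q\psi]_u=Q(u)\psi_u$. $Q$ is $(p_1,p_2)$-periodic if $Q(u+p_1\bm{b}_+)=Q(u+p_2\bm{b}_-)=Q(u)$ for all $u\in\mathcal{V}_{\mathrm{hex}}$. $\sigma$ denotes spectrum. *)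

(* Defs.v *)
From HB Require Import structures.
From mathcomp Require Import all_boot all_order all_algebra.
From mathcomp Require Import all_classical all_reals all_analysis.
From mathcomp Require Import complex.

Set Implicit Arguments.
Unset Strict Implicit.
Unset Printing Implicit Defensive.

Import Order.TTheory GRing.Theory Num.Theory.
Import numFieldNormedType.Exports.

Local Open Scope classical_set_scope.
Local Open Scope ring_scope.

Section Ell2.
Variables (R : realType) (I : choiceType).
Implicit Types (psi phi : I -> R[i]) (A T S : (I -> R[i]) -> (I -> R[i])).

Definition ell2_normsq psi : \bar R :=
  \esum_(u in [set: I]) (Normc.normc (psi u) ^+ 2)%:E.

Definition ell2 : set (I -> R[i]) := [set psi | (ell2_normsq psi < +oo)%E].

                                      
Definition ell2_norm psi : R := Num.sqrt (fine (ell2_normsq psi)).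

                                                                              
              
Definition bounded_operator A : Prop :=
  [/\ forall psi, ell2 psi -> ell2 (A psi),
      forall (a : R[i]) phi psi, ell2 phi -> ell2 psi ->
        A (fun u => a * phi u + psi u) = (fun u => a * A phi u + A psi u)
    & exists M : R, forall psi, ell2 psi ->
        ell2_norm (A psi) <= M * ell2_norm psi].

Definition shift_operator T (z : R[i]) : (I -> R[i]) -> (I -> R[i]) :=
  fun psi u => T psi u - z * psi u.

Definition resolvent_set T : set R[i] :=
  [set z | exists2 S, bounded_operator S &
     forall psi, ell2 psi ->
       S (shift_operator T z psi) = psi /\ shift_operator T z (S psi) = psi].

Definition spectrum T : set R[i] := ~` resolvent_set T.

End Ell2.

                                                                     
Definition connected_components (R : realType) (A : set R[i]) :
    set (set R[i]) :=
  [set @connected_component (R[i] : numFieldType) A z | z in A].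

Section Hexagonal.
Variable R : realType.

Definition hex_a1 : R * R := (1, 0).
Definition hex_bp : R * R := (3 / 2, Num.sqrt 3 / 2).
Definition hex_bm : R * R := (3 / 2, - (Num.sqrt 3 / 2)).

Definition Vhex : set (R * R) :=
  [set hex_bp *~ nm.1 + hex_bm *~ nm.2 | nm in [set: int * int]] `|`
  [set hex_a1 + hex_bp *~ nm.1 + hex_bm *~ nm.2 | nm in [set: int * int]].

                                                         
Definition euclidean_dist (u v : R * R) : R :=
  Num.sqrt ((u.1 - v.1) ^+ 2 + (u.2 - v.2) ^+ 2).

Definition hex_neighbors (u : Vhex) : set Vhex :=
  [set v | euclidean_dist (\val u) (\val v) = 1].

Definition hex_laplacian (psi : Vhex -> R[i]) : Vhex -> R[i] :=
  fun u => \sum_(v \in hex_neighbors u) psi v.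

Definition hex_schrodinger (Q : Vhex -> R) (psi : Vhex -> R[i]) :
    Vhex -> R[i] :=
  fun u => hex_laplacian psi u + (Q u)%:C%C * psi u.

                                                                               
Definition hex_periodic (p1 p2 : nat) (Q : Vhex -> R) : Prop :=
  (forall u v : Vhex, \val v = \val u + hex_bp *+ p1 -> Q v = Q u) /\
  (forall u v : Vhex, \val v = \val u + hex_bm *+ p2 -> Q v = Q u).

End Hexagonal.

Arguments Vhex : clear implicits.

(* Main.v *)
(** Write the operator H as the sum of three involutive hops, one for each edge
    direction, and a real potential.  H - z is invertible as soon as it is bounded
    below on finitely supported functions; conversely a bounded solution of
    H psi = E psi, multiplied by slowly decaying weights, shows that E is in the
    spectrum.  Averaging over roots of unity (Parseval) reduces the lower bound to
    the Bloch fibers of H, so the spectrum is the set of eigenvalues of the fibers.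

    For (1), take +1 on one sublattice and -1 on the other: the fibers satisfy
    E^2 = l^2 + |1 + x + y|^2 with x, y on the unit circle, hence l^2 <= E^2 <= 9 + l^2.

    For (2), the period cell is a cube and the potential is the majority sign of
    the three coordinates.  The fiber determinant depends on E only through
    w = E^2 - 1 - l^2 and equals
      w^4 - 8 w^3 - 12 l^2 w^2 + 8 S w (w + 2 l^2) - 64 P,
    where S and P are the sum and the product of the squared sines of the angles of
    x, y and x / y.  It has a constant sign on the torus when w is above the larger
    root of w^2 - 8 w - 12 l^2, between its smaller root and 0, or below the zero
    close to -1 given by the Dirac point (S = 9/4, P = 27/64); otherwise it vanishes
    somewhere, by the intermediate value theorem.  The energies -1, 0 and 1 therefore
    lie in gaps, and each of the four remaining ranges contributes one interval. *)

(* For zero coupling the spectrum is the single interval [-3, 3], so a gap has to open at 0, where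
   the Dirac cones touch, and at 1 and -1. Folding onto the 2 x 2 cell makes these two energies
   degenerate: for x = y = 1 the four numbers |1 ± x ± y|^2 are 9, 1, 1, 1, which is the part w^4 -
   8 w^3 = (w - 8) w^3 of the determinant, and the triple root w = 0 splits under the potential. The
   majority sign is odd under the antipodal map of the cube, which exchanges the two sublattices;
   composed with the sublattice sign it turns H into -H, and this is why E enters only through E^2.

   A lower bound is needed only on finitely supported functions, and each of them fits into a finite
   box, so a finite sum over roots of unity replaces integration over the torus. The order of these
   roots depends on the box, hence the fiber bounds must be uniform over all phases. They come from
   explicit solution formulas (Cramer) with bounded coefficients, not from compactness. *)
Require Import Defs.
From HB Require Import structures.
From mathcomp Require Import all_boot all_order all_algebra.
From mathcomp Require Import all_classical all_reals all_analysis.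
From mathcomp Require Import complex.
From mathcomp Require Import ring lra zify.
Import Order.TTheory GRing.Theory Num.Theory.
Import numFieldNormedType.Exports.
Local Open Scope classical_set_scope.
Local Open Scope card_scope.
Local Open Scope ring_scope.

Set Implicit Arguments.
Unset Strict Implicit.
Unset Printing Implicit Defensive.

(** * Square-summable functions *)

Section SquaredModulus.
Variable R : realType.
Implicit Types x y z : R[i].

Definition nsq x : R := complex.Re x ^+ 2 + complex.Im x ^+ 2.

Lemma nsq_normc x : Normc.normc x ^+ 2 = nsq x.
Proof. by case: x => a b; rewrite /nsq /= sqr_sqrtr// addr_ge0 ?sqr_ge0. Qed.

Lemma nsqE x : (nsq x)%:C%C = x * (x^*)%C.
Proof. by rewrite -sqr_normc -add_Re2_Im2. Qed.

Lemma nsq_ge0 x : 0 <= nsq x.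
Proof. by rewrite addr_ge0 ?sqr_ge0. Qed.

Lemma nsq0 : nsq 0 = 0.
Proof. by rewrite /nsq /= expr0n addr0. Qed.

Lemma nsq_eq0 x : (nsq x == 0) = (x == 0).
Proof.
by case: x => a b; rewrite paddr_eq0 ?sqr_ge0// !sqrf_eq0 eq_complex.
Qed.

Lemma nsqM x y : nsq (x * y) = nsq x * nsq y.
Proof. by case: x => a b; case: y => c d; rewrite /nsq /=; ring. Qed.

Lemma nsqN x : nsq (- x) = nsq x.
Proof. by case: x => a b; rewrite /nsq /= !sqrrN. Qed.

Lemma nsqJ x : nsq (x^*)%C = nsq x.
Proof. by case: x => a b; rewrite /nsq /= sqrrN. Qed.

Lemma nsq_real (a : R) : nsq (a%:C)%C = a ^+ 2.
Proof. by rewrite /nsq /= expr0n addr0. Qed.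

(** The two sides differ by [nsq (x - d * y) / d]. The weights 1, 2, 3 yield the constants 2, 3, 4
    for sums of two, three and four terms; a small [d] costs [y] almost nothing, which preserves a
    contraction factor. *)
Lemma nsqD_weighted (d : R) x y : 0 < d ->
  nsq (x + y) <= (1 + d^-1) * nsq x + (1 + d) * nsq y.
Proof.
case: x => a b; case: y => c e d0; rewrite /nsq /=.
have H (u v : R) : (u + v) ^+ 2 <= (1 + d^-1) * u ^+ 2 + (1 + d) * v ^+ 2.
  have -> : (1 + d^-1) * u ^+ 2 + (1 + d) * v ^+ 2 =
            (u + v) ^+ 2 + d^-1 * (u - d * v) ^+ 2 by field; rewrite gt_eqF.
  by rewrite lerDl mulr_ge0 ?sqr_ge0// invr_ge0 ltW.
by have := H a c; have := H b e; lra.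
Qed.

Lemma nsqD x y : nsq (x + y) <= 2 * (nsq x + nsq y).
Proof. by have := @nsqD_weighted 1 x y ltr01; rewrite invr1; lra. Qed.

Lemma nsqB x y : nsq (x - y) <= 2 * (nsq x + nsq y).
Proof. by rewrite -(nsqN y) nsqD. Qed.

Lemma nsqD3 x y z : nsq (x + y + z) <= 3 * (nsq x + nsq y + nsq z).
Proof.
have := @nsqD_weighted 2 (x + y) z (ltr0n R 2); have := nsqD x y.
by lra.
Qed.

End SquaredModulus.

Section SquareSummable.
Variables (R : realType) (I : choiceType).
Implicit Types (psi phi : I -> R[i]) (C : R) (s : seq I).

(** Bounding finite partial sums keeps all later estimates inside [R]; [ell2_normsq_le] is the
    bridge to the extended-real sum. *)
Definition ell2_le psi C :=
  forall s, uniq s -> \sum_(u <- s) nsq (psi u) <= C.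

Lemma ell2_normsq_le psi C : ell2_le psi C <-> (ell2_normsq psi <= C%:E)%E.
Proof.
have E s : uniq s -> (\sum_(u \in [set` s]) (Normc.normc (psi u) ^+ 2)%:E)%E
                     = (\sum_(u <- s) nsq (psi u))%:E.
  move=> us; rewrite -fsbig_seq// sumEFin; congr EFin.
  by apply: eq_bigr => u _; rewrite nsq_normc.
split=> [H|H s us].
- rewrite /ell2_normsq /esum; apply: ge_ereal_sup => _ [A [fA _] <-].
  move/finite_seqP: fA => [s ->].
  have -> : [set` s] = [set` undup s] by apply/seteqP; split => x /=; rewrite mem_undup.
  by rewrite E ?undup_uniq// lee_fin H ?undup_uniq.
- rewrite -lee_fin -E//; apply: le_trans H.
  by apply: esum_ge; exists [set` s].
Qed.


Lemma ell2P psi : ell2 psi <-> exists C, ell2_le psi C.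
Proof.
split=> [h|[C /ell2_normsq_le h]]; last exact: le_lt_trans h (ltry _).
exists (fine (ell2_normsq psi)); apply/ell2_normsq_le; rewrite fineK//.
rewrite ge0_fin_numE//; apply: esum_ge0 => u _.
by rewrite lee_fin sqr_ge0.
Qed.

Lemma ell2_le_norm psi : ell2 psi -> ell2_le psi (ell2_norm psi ^+ 2).
Proof.
move=> h; have p0 : (0 <= ell2_normsq psi)%E.
  by apply: esum_ge0 => u _; rewrite lee_fin sqr_ge0.
rewrite sqr_sqrtr ?fine_ge0//; apply/ell2_normsq_le.
by rewrite fineK// ge0_fin_numE.
Qed.

Lemma ell2_le_ge0 psi C : ell2_le psi C -> 0 <= C.
Proof. by move=> /(_ [::] isT); rewrite big_nil. Qed.

Lemma ell2_norm_le psi C : 0 <= C -> ell2_le psi (C ^+ 2) -> ell2_norm psi <= C.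
Proof.
move=> C0 h; rewrite -(ger0_norm C0) -sqrtr_sqr; apply: ler_wsqrtr.
have p0 : (0 <= ell2_normsq psi)%E.
  by apply: esum_ge0 => u _; rewrite lee_fin sqr_ge0.
have h' : ell2 psi by apply/ell2P; exists (C ^+ 2).
by rewrite -lee_fin fineK ?ge0_fin_numE//; apply/ell2_normsq_le.
Qed.

Lemma ell2_le_pt psi C u : ell2_le psi C -> nsq (psi u) <= C.
Proof. by move=> /(_ [:: u] isT); rewrite big_seq1. Qed.

Lemma ell2_leD (d : R) phi psi C D : 0 < d -> ell2_le phi C -> ell2_le psi D ->
  ell2_le (fun u => phi u + psi u) ((1 + d^-1) * C + (1 + d) * D).
Proof.
move=> d0 hC hD s us.
apply: le_trans (ler_sum _ (fun u _ => @nsqD_weighted _ d _ _ d0)) _.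
rewrite big_split -!mulr_sumr lerD// ler_wpM2l ?hC ?hD//.
  by rewrite addr_ge0// invr_ge0 ltW.
by rewrite addr_ge0// ltW.
Qed.

Lemma ell2_leZ (a : R[i]) psi C : ell2_le psi C ->
  ell2_le (fun u => a * psi u) (nsq a * C).
Proof.
move=> h s us; rewrite (eq_bigr (fun u => nsq a * nsq (psi u))).
  by rewrite -mulr_sumr ler_wpM2l ?nsq_ge0// h.
by move=> u _; rewrite nsqM.
Qed.

Lemma ell2_le_inj (f : I -> I) psi C : injective f -> ell2_le psi C ->
  ell2_le (fun u => psi (f u)) C.
Proof.
move=> fI h s us.
rewrite -(big_map f xpredT (fun u => nsq (psi u))).
by rewrite h// map_inj_uniq.
Qed.

Lemma ler_sum_sub (f : I -> R) s t : uniq s -> {subset s <= t} ->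
  (forall u, 0 <= f u) -> \sum_(u <- s) f u <= \sum_(u <- t) f u.
Proof.
elim: s t => [|x s IH] t /=; first by move=> *; rewrite big_nil sumr_ge0.
move=> /andP[xs us] st f0.
have xt : x \in t by rewrite st// inE eqxx.
rewrite big_cons (perm_big _ (perm_to_rem xt)) big_cons lerD2l IH// => u us'.
have ut : u \in t by rewrite st// inE us' orbT.
move: ut; rewrite (perm_mem (perm_to_rem xt)) inE => /orP[/eqP ux|//].
by move: xs; rewrite -ux us'.
Qed.

Lemma sum_support (V : nmodType) (f : I -> V) s t : uniq s -> uniq t ->
  (forall u, u \notin s -> f u = 0) -> (forall u, u \notin t -> f u = 0) ->
  \sum_(u <- s) f u = \sum_(u <- t) f u.
Proof.
move=> us ut fs ft.
rewrite (bigID (mem t)) /= [X in _ + X]big1 => [|u /ft//].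
rewrite [RHS](bigID (mem s)) /= [X in _ = _ + X]big1 => [|u /fs//].
rewrite !addr0 -big_filter -[RHS]big_filter; apply: perm_big.
apply: uniq_perm; rewrite ?filter_uniq// => u.
by rewrite !mem_filter andbC.
Qed.

Lemma ell2_le_support psi s : uniq s -> (forall u, u \notin s -> psi u = 0) ->
  ell2_le psi (\sum_(u <- s) nsq (psi u)).
Proof.
move=> us h t ut.
have -> : \sum_(u <- s) nsq (psi u) = \sum_(u <- undup (s ++ t)) nsq (psi u).
  apply: sum_support; rewrite ?undup_uniq// => u.
    by move=> /h ->; rewrite nsq0.
  by rewrite mem_undup mem_cat negb_or => /andP[/h-> _]; rewrite nsq0.
apply: ler_sum_sub => // [u ut'|u]; last exact: nsq_ge0.
by rewrite mem_undup mem_cat ut' orbT.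
Qed.

End SquareSummable.

(** * Convergence of complex sequences through real and imaginary parts *)

Section ComplexSequences.
Variable R : realType.
Implicit Types (x y : nat -> R[i]) (l m k : R[i]).

Definition ccvg x l :=
  ((fun n => complex.Re (x n)) @ \oo --> complex.Re l) /\
  ((fun n => complex.Im (x n)) @ \oo --> complex.Im l).

Lemma ccvg_unique x l m : ccvg x l -> ccvg x m -> l = m.
Proof.
case: l m => [l1 l2] [m1 m2] [/= a1 a2] [/= b1 b2].
by rewrite (cvg_unique (@Rhausdorff R) a1 b1) (cvg_unique (@Rhausdorff R) a2 b2).
Qed.

Lemma ccvgD x y l m : ccvg x l -> ccvg y m -> ccvg (fun n => x n + y n) (l + m).
Proof.
have E : forall u v : R[i], complex.Re (u + v) = complex.Re u + complex.Re v
    /\ complex.Im (u + v) = complex.Im u + complex.Im v by case=> ? ? [].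
move=> [a1 a2] [b1 b2]; split; rewrite (E l m).1 || rewrite (E l m).2.
  by under eq_fun do rewrite (E _ _).1; exact: cvgD.
by under eq_fun do rewrite (E _ _).2; exact: cvgD.
Qed.

Lemma ccvgZ k x l : ccvg x l -> ccvg (fun n => k * x n) (k * l).
Proof.
case: k => k1 k2.
have E1 : forall u : R[i], complex.Re ((k1 +i* k2)%C * u) =
  k1 * complex.Re u - k2 * complex.Im u by case.
have E2 : forall u : R[i], complex.Im ((k1 +i* k2)%C * u) =
  k1 * complex.Im u + k2 * complex.Re u by case.
move=> [a1 a2]; split; rewrite (E1, E2).
  by under eq_fun do rewrite E1; apply: cvgB; exact: cvgMr.
by under eq_fun do rewrite E2; apply: cvgD; exact: cvgMr.
Qed.

Lemma ccvg_nsq x l : ccvg x l -> (fun n => nsq (x n)) @ \oo --> nsq l.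
Proof. by move=> [a1 a2]; apply: cvgD; rewrite expr2; apply: cvgM. Qed.

Definition clim x : R[i] :=
  (lim ((fun n => complex.Re (x n)) @ \oo) +i*
   lim ((fun n => complex.Im (x n)) @ \oo))%C.

Lemma nsq_Re (z : R[i]) : `|complex.Re z| <= Num.sqrt (nsq z).
Proof. by rewrite -sqrtr_sqr; apply: ler_wsqrtr; rewrite lerDl sqr_ge0. Qed.

Lemma nsq_Im (z : R[i]) : `|complex.Im z| <= Num.sqrt (nsq z).
Proof. by rewrite -sqrtr_sqr; apply: ler_wsqrtr; rewrite lerDr sqr_ge0. Qed.

Lemma series_dominated_cvg (u : nat -> R) r C : 0 <= r < 1 ->
  (forall n, `|u n| <= C * r ^+ n) -> cvgn (series u).
Proof.
move=> /andP[r0 r1] h; apply: normed_cvg.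
apply: (@series_le_cvg _ _ (geometric C r)).
- by move=> n; exact: normr_ge0.
- by move=> n; exact: le_trans (h n).
- by move=> n; exact: h.
- by apply: is_cvg_geometric_series; rewrite ger0_norm.
Qed.

Lemma ccvg_series x r C : 0 <= r < 1 -> 0 <= C ->
  (forall n, nsq (x n) <= r ^+ n * C) ->
  ccvg (fun n => \sum_(k < n) x k) (clim (fun n => \sum_(k < n) x k)).
Proof.
move=> /andP[r0 r1] C0 h.
have b n : Num.sqrt (nsq (x n)) <= Num.sqrt C * Num.sqrt r ^+ n.
  rewrite -[Num.sqrt r ^+ n]ger0_norm ?exprn_ge0 ?sqrtr_ge0//.
  rewrite -sqrtr_sqr -exprM mulnC exprM sqr_sqrtr// -sqrtrM// mulrC.
  exact: ler_wsqrtr.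
have sr : 0 <= Num.sqrt r < 1 by rewrite sqrtr_ge0 -sqrtr1 ltr_sqrt ?ltr01.
have EE (f : R[i] -> R) : {morph f : u v / u + v} -> f 0 = 0 ->
    (fun n => f (\sum_(k < n) x k)) = series (fun j => f (x j)).
  move=> fD f0; apply/funext => n; rewrite /series /= big_mkord.
  exact: (big_morph f fD f0).
have E1 : {morph (@complex.Re R) : u v / u + v} by case=> ? ? [].
have E2 : {morph (@complex.Im R) : u v / u + v} by case=> ? ? [].
split=> /=; rewrite EE//; apply: (@series_dominated_cvg _ _ (Num.sqrt C) sr) => n.
  exact: le_trans (nsq_Re _) (b n).
exact: le_trans (nsq_Im _) (b n).
Qed.

Lemma ccvg_geometric0 x r C : 0 <= r < 1 ->
  (forall n, nsq (x n) <= r ^+ n * C) -> ccvg x 0.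
Proof.
move=> /andP[r0 r1] h.
have z : (fun n => r ^+ n * C) @ \oo --> (0 : R).
  rewrite -(mul0r C); apply: cvgMl; apply: cvg_expr; by rewrite ger0_norm.
have sq (u : nat -> R) : (forall n, u n ^+ 2 <= r ^+ n * C) -> u @ \oo --> (0 : R).
  move=> hu; apply: norm_cvg0.
  have -> : (fun n => `|u n|) = (fun n => Num.sqrt (u n ^+ 2)).
    by apply/funext => n; rewrite sqrtr_sqr.
  rewrite -[X in _ --> X]sqrtr0; apply: continuous_cvg; first exact: sqrt_continuous.
  apply: (squeeze_cvgr _ (cvg_cst 0) z); near=> n; by rewrite sqr_ge0 hu.
split; apply: sq => n; apply: le_trans (h n).
  by rewrite lerDl sqr_ge0.
by rewrite lerDr sqr_ge0.
Unshelve. all: by end_near.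
Qed.

End ComplexSequences.

(** * Inverting bounded below operators *)

Section ThreeHops.
Variables (R : realType) (I : choiceType) (a b c : I -> I).
Hypotheses (aK : involutive a) (bK : involutive b) (cK : involutive c).
Implicit Types (p : I -> R[i]) (psi phi : I -> R[i]) (s : seq I).

Definition hop p psi u : R[i] := psi (a u) + psi (b u) + psi (c u) + p u * psi u.
Definition conjf p u : R[i] := (p u)^*%C.

Lemma hopZD p (k : R[i]) phi psi u :
  hop p (fun v => k * phi v + psi v) u = k * hop p phi u + hop p psi u.
Proof. by rewrite /hop; ring. Qed.

Lemma hop_bound p (B : R) psi C : 0 <= B -> (forall u, nsq (p u) <= B) -> ell2_le psi C ->
  ell2_le (hop p psi) (4 * (3 + B) * C).
Proof.
move=> B0 pB hC s us.
have le4 (w x y z : R[i]) :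
    nsq (w + x + y + z) <= 4 * (nsq w + nsq x + nsq y + nsq z).
  by have := @nsqD_weighted _ 3 (w + x + y) z (ltr0n R 3);
     have := nsqD3 w x y; lra.
apply: le_trans (ler_sum _ (fun u _ => le4 _ _ _ _)) _.
rewrite -mulr_sumr -mulrA ler_wpM2l// 3!big_split /= mulrDl.
have hp : \sum_(u <- s) nsq (p u * psi u) <= B * C.
  apply: le_trans (_ : B * \sum_(u <- s) nsq (psi u) <= _).
    by rewrite mulr_sumr ler_sum// => u _; rewrite nsqM ler_wpM2r ?nsq_ge0.
  by rewrite ler_wpM2l ?hC.
have h (f : I -> I) : involutive f -> \sum_(u <- s) nsq (psi (f u)) <= C.
  by move=> /inv_inj fI; apply: (ell2_le_inj fI hC).
have := h a aK; have := h b bK; have := h c cK; lra.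
Qed.

Definition supp_in s psi := forall u, u \notin s -> psi u = 0.

Lemma sum_swap (f : I -> I) s phi psi : involutive f -> uniq s ->
  supp_in s phi -> supp_in s psi ->
  \sum_(u <- s) (phi u)^*%C * psi (f u) = \sum_(u <- s) (phi (f u))^*%C * psi u.
Proof.
move=> fK us hphi hpsi.
transitivity (\sum_(u <- map f s) (phi (f u))^*%C * psi u).
  by rewrite big_map; apply: eq_bigr => u _; rewrite fK.
apply: sum_support => //; first by rewrite map_inj_uniq//; exact: inv_inj.
  move=> u; apply: contraNeq; rewrite mulf_eq0 negb_or => /andP[h _].
  apply/mapP; exists (f u); last by rewrite fK.
  apply: contraNT h => /hphi->; by rewrite conjc0.
by move=> u /hpsi->; rewrite mulr0.
Qed.

(** Each hop is an involution, hence symmetric under reindexing, and only the potential gets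
    conjugated. Terms where a hop leaves [s] vanish because of the other factor, so [s] need not be
    stable under hops. *)
Lemma hop_adjoint p s phi psi : uniq s -> supp_in s phi -> supp_in s psi ->
  \sum_(u <- s) (phi u)^*%C * hop p psi u
    = \sum_(u <- s) (hop (conjf p) phi u)^*%C * psi u.
Proof.
move=> us hphi hpsi.
under eq_bigr do rewrite /hop !mulrDr.
under [RHS]eq_bigr do rewrite /hop !rmorphD !mulrDl.
rewrite !big_split /= !(@sum_swap _ s phi psi)//; congr (_ + _).
by apply: eq_bigr => u _; rewrite rmorphM /= conjcK; ring.
Qed.

Definition nbhd s := undup (s ++ map a s ++ map b s ++ map c s).

Lemma nbhd_uniq s : uniq (nbhd s). Proof. exact: undup_uniq. Qed.

Lemma sub_nbhd s : {subset s <= nbhd s}.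
Proof. by move=> u us; rewrite mem_undup mem_cat us. Qed.

Lemma nbhd_hops s u : u \in s ->
  [/\ u \in nbhd s, a u \in nbhd s, b u \in nbhd s & c u \in nbhd s].
Proof.
by move=> us; split; rewrite mem_undup !mem_cat ?us ?map_f ?orbT.
Qed.

Lemma supp_hop p s psi : supp_in s psi -> supp_in (nbhd s) (hop p psi).
Proof.
move=> h u; rewrite mem_undup !mem_cat !negb_or => /and4P[u0 u1 u2 u3].
have mf (f : I -> I) : involutive f -> u \notin map f s -> psi (f u) = 0.
  move=> fK ufs; apply: h; apply: contra ufs => fus.
  by apply/mapP; exists (f u); rewrite ?fK.
by rewrite /hop (mf a)// (mf b)// (mf c)// h// mulr0 !addr0.
Qed.

Lemma supp_in_sub s t psi : {subset s <= t} -> supp_in s psi -> supp_in t psi.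
Proof. by move=> st h u ut; apply: h; apply: contra ut => /st. Qed.

Lemma hop_local p phi psi s : {in nbhd s, phi =1 psi} -> {in s, hop p phi =1 hop p psi}.
Proof. by move=> h u /nbhd_hops[u0 u1 u2 u3]; rewrite /hop !h. Qed.

Lemma contract_arith (K e X Y Z C : R) : 0 < K -> e <= K ->
  e * X <= Y -> Z <= K * Y -> X <= C ->
  X - 2 * K^-1 * Y + K^-1 ^+ 2 * Z <= (1 - e / K) * C.
Proof.
move=> K0 eK l1 l2 l3.
have Ki0 : 0 < K^-1 by rewrite invr_gt0.
have rho0 : 0 <= 1 - e / K by rewrite subr_ge0 ler_pdivrMr// mul1r.
apply: le_trans (_ : (1 - e / K) * X <= _); last exact: ler_wpM2l.
have : K^-1 ^+ 2 * Z <= K^-1 * Y.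
  by rewrite expr2 -mulrA (ler_wpM2l (ltW Ki0))// ler_pdivrMl.
have : K^-1 * (e * X) <= K^-1 * Y by rewrite (ler_wpM2l (ltW Ki0)).
lra.
Qed.

Section Inverse.
Variables (p : I -> R[i]) (B e : R).
Hypotheses (B0 : 0 <= B) (pB : forall u, nsq (p u) <= B) (e0 : 0 < e).
Hypothesis low : forall s psi, uniq s -> supp_in s psi -> supp_in s (hop p psi) ->
  e * \sum_(u <- s) nsq (psi u) <= \sum_(u <- s) nsq (hop p psi u).

(** The part [4 * (3 + B)] is the squared operator bound of [hop_bound]; the summand [e] ensures
    [e <= K], so that [rho] lies in [[0, 1)]. *)
Let K : R := 4 * (3 + B) + e.
Let gram psi := hop (conjf p) (hop p psi).
Let step psi u : R[i] := psi u - (K^-1)%:C%C * gram psi u.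
Let rho : R := 1 - e / K.

Let K0 : 0 < K. Proof. by rewrite /K ltr_wpDl// mulr_ge0// addr_ge0. Qed.

Lemma nsq_sub_real (k : R) (x y : R[i]) :
  nsq (x - (k%:C)%C * y) =
  nsq x - 2 * k * complex.Re (x^*%C * y) + k ^+ 2 * nsq y.
Proof. by case: x => x1 x2; case: y => y1 y2; rewrite /nsq /=; ring. Qed.

Lemma Re_sum (J : Type) (r : seq J) (F : J -> R[i]) :
  complex.Re (\sum_(i <- r) F i) = \sum_(i <- r) complex.Re (F i).
Proof. exact: (@raddf_sum _ _ (@complex.Re R : Rcomplex R -> R)). Qed.

(* Writing T for the operator, |psi - T^* T psi / K|^2 = |psi|^2 - 2 |T psi|^2 / K
   + |T^* T psi|^2 / K^2 <= |psi|^2 - |T psi|^2 / K as soon as |T^*|^2 <= K; hence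
   the Neumann series for T^* T converges. *)
Lemma step_contract psi C :
  ell2_le psi C -> ell2_le (step psi) (rho * C).
Proof.
move=> hC s us.
(* [low] speaks of finitely supported functions only. Since [step] moves by at most two hops,
   truncating [psi] outside [s2] does not change [step psi] on [s]; two further neighborhoods leave
   room for the images of the truncation. *)
pose s2 := nbhd (nbhd s); pose psi' u := if u \in s2 then psi u else 0.
have E : {in s, step psi =1 step psi'}.
  have e2 : {in s2, psi =1 psi'} by move=> u; rewrite /psi' => ->.
  move=> u us'; rewrite /step /gram; congr (_ - _ * _).
    by rewrite e2// /s2; do 2!apply: sub_nbhd.
  exact: (@hop_local (conjf p) _ _ s (hop_local p e2) u us').
pose s4 := nbhd (nbhd s2).
have u4 : uniq s4 by exact: nbhd_uniq.
have sub24 : {subset s2 <= s4} by move=> u h; do 2!apply: sub_nbhd.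
have h2 : supp_in s2 psi' by move=> u; rewrite /psi' => /negPf->.
have h4 : supp_in s4 psi' by exact: supp_in_sub sub24 h2.
have h4' : supp_in s4 (hop p psi').
  by apply: supp_in_sub (supp_hop p h2) => u; exact: sub_nbhd.
rewrite big_seq (eq_bigr (fun u => nsq (step psi' u))) => [|u /E-> //].
rewrite -big_seq.
apply: le_trans (_ : _ <= \sum_(u <- s4) nsq (step psi' u)) _.
  apply: ler_sum_sub => // [u h|u]; last exact: nsq_ge0.
  by apply: sub24; do 2!apply: sub_nbhd.
under eq_bigr do rewrite nsq_sub_real.
rewrite 2!big_split /= sumrN -!mulr_sumr -Re_sum.
rewrite (hop_adjoint _ u4 h4 h4').
have -> : conjf (conjf p) = p by apply/funext => u; rewrite /conjf conjcK.
have -> : complex.Re (\sum_(u <- s4) (hop p psi' u)^*%C * hop p psi' u)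
        = \sum_(u <- s4) nsq (hop p psi' u).
  rewrite Re_sum; apply: eq_bigr => u _; rewrite mulrC -nsqE //.
have l1 := low u4 h4 h4'.
have l2 : \sum_(u <- s4) nsq (gram psi' u) <= K * \sum_(u <- s4) nsq (hop p psi' u).
  have pB' u : nsq (conjf p u) <= B by rewrite nsqJ.
  have := @hop_bound _ B (hop p psi') _ B0 pB' (ell2_le_support u4 h4') _ u4.
  move=> /le_trans; apply; apply: ler_wpM2r; first by apply: sumr_ge0 => *; exact: nsq_ge0.
  by rewrite /K lerDl ltW.
have l3 : \sum_(u <- s4) nsq (psi' u) <= C.
  rewrite (@sum_support _ _ (fun u => nsq (psi' u)) s4 s2)//; last 3 first.
  - exact: nbhd_uniq.
  - by move=> u /h4->; rewrite nsq0.
  - by move=> u /h2->; rewrite nsq0.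
  apply: le_trans (hC s2 (nbhd_uniq _)); rewrite big_seq [leRHS]big_seq.
  by apply: ler_sum => u; rewrite /psi' => ->.
set X := \sum_(u <- s4) nsq (psi' u) in l1 l3 *.
set Y := \sum_(u <- s4) nsq (hop p psi' u) in l1 l2 *.
set Z := \sum_(u <- s4) nsq (gram psi' u) in l2 *.
apply: contract_arith l1 l2 l3; rewrite // /K lerDr mulr_ge0// addr_ge0//.
Qed.


Let partial f n u : R[i] := \sum_(j < n) iter j step f u.
Let neumann f u : R[i] := clim (fun n => partial f n u).

Let rho01 : 0 <= rho < 1.
Proof.
rewrite /rho subr_ge0 ler_pdivrMr// mul1r ltrBlDr ltrDl divr_gt0// andbT.
by rewrite /K lerDr mulr_ge0// addr_ge0.
Qed.

Let gramZD k phi psi u :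
  gram (fun v => k * phi v + psi v) u = k * gram phi u + gram psi u.
Proof.
rewrite /gram; have -> : hop p (fun v => k * phi v + psi v) =
  fun v => k * hop p phi v + hop p psi v by apply/funext => v; exact: hopZD.
exact: hopZD.
Qed.

Let stepZD k phi psi :
  step (fun v => k * phi v + psi v) = fun u => k * step phi u + step psi u.
Proof. by apply/funext => u; rewrite /step gramZD; ring. Qed.

Let iter_stepZD k phi psi n : iter n step (fun v => k * phi v + psi v) =
  fun u => k * iter n step phi u + iter n step psi u.
Proof. by elim: n => //= n ->; rewrite stepZD. Qed.

Let iter_step_le f C n : ell2_le f C -> ell2_le (iter n step f) (rho ^+ n * C).
Proof.
move=> fC; elim: n => [|n IH]; first by rewrite mul1r.
by rewrite exprS -mulrA; apply: step_contract.
Qed.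

Let neumann_cvg f u : ell2 f -> ccvg (fun n => partial f n u) (neumann f u).
Proof.
move=> /ell2P[C fC]; apply: (@ccvg_series _ (fun n => iter n step f u) rho C rho01
  (ell2_le_ge0 fC)) => n.
exact: ell2_le_pt (iter_step_le n fC).
Qed.

Let gram_step psi u : gram psi u = K%:C%C * (psi u - step psi u).
Proof.
rewrite /step opprB addrC subrK mulrA -rmorphM /= mulfV ?gt_eqF//.
by rewrite mul1r.
Qed.

Let gram_partial f n u :
  gram (partial f n) u = K%:C%C * (f u - iter n step f u).
Proof.
elim: n u => [|n IH] u.
  rewrite subrr mulr0 /gram /hop /partial !big_ord0 !mulr0; ring.
have -> : partial f n.+1 = fun u => 1 * iter n step f u + partial f n u.
  by apply/funext => v; rewrite /partial big_ord_recr /= addrC mul1r.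
rewrite gramZD IH gram_step /=; ring.
Qed.

Let gram_neumann f u : ell2 f -> gram (neumann f) u = K%:C%C * f u.
Proof.
move=> lf; have cv := fun v => @neumann_cvg f v lf.
have hcv (r : I -> R[i]) (x : nat -> I -> R[i]) l v :
    (forall v, ccvg (fun n => x n v) (l v)) ->
    ccvg (fun n => hop r (x n) v) (hop r l v).
  by move=> h; rewrite /hop; do 3?apply: ccvgD => //; apply: ccvgZ.
apply: (ccvg_unique (x := fun n => gram (partial f n) u)).
  by apply: (hcv) => v; apply: (hcv).
have -> : (fun n => gram (partial f n) u) =
    fun n => K%:C%C * f u + (- K%:C%C) * iter n step f u.
  by apply/funext => n; rewrite gram_partial; ring.
have cst (k : R[i]) : ccvg (fun=> k) k by split; exact: cvg_cst.
rewrite -[X in ccvg _ X]addr0 -[X in _ + X](mulr0 (- K%:C%C)).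
apply: ccvgD => //; apply: ccvgZ; move/ell2P: lf => [C fC].
apply: (@ccvg_geometric0 _ _ rho C rho01) => n.
exact: ell2_le_pt (iter_step_le n fC).
Qed.

Let neumann_linear k f g u : ell2 f -> ell2 g ->
  neumann (fun v => k * f v + g v) u = k * neumann f u + neumann g u.
Proof.
move=> /[dup] lf /ell2P[C fC] /[dup] lg /ell2P[D gD].
have lfg : ell2 (fun v => k * f v + g v).
  by apply/ell2P; eexists; exact: (ell2_leD ltr01 (ell2_leZ k fC) gD).
apply: ccvg_unique (neumann_cvg u lfg) _.
have -> : (fun n => partial (fun v => k * f v + g v) n u) =
    fun n => k * partial f n u + partial g n u.
  apply/funext => n; rewrite /partial mulr_sumr -big_split /=.
  by apply: eq_bigr => j _; rewrite iter_stepZD.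
by apply: ccvgD; [apply: ccvgZ|]; exact: neumann_cvg.
Qed.

Let partialS f n : partial f n.+1 = fun u => f u + step (partial f n) u.
Proof.
apply/funext => u; rewrite /step gram_partial mulrA -rmorphM /=.
rewrite mulVf ?gt_eqF// mul1r /partial big_ord_recr /=; ring.
Qed.

(** By [partialS], a bound [D] on the partial sums reproduces itself once D = (1 + 1/d) + (1 + d)
    rho D, which is solvable when (1 + d) rho < 1. The bound then passes to the limit on every
    finite set of sites. *)
Let neumann_bound : exists2 D, 0 <= D &
  forall f C, ell2_le f C -> ell2_le (neumann f) (D * C).
Proof.
have [/= r0 r1] := andP rho01.
(* With this [d], 1 - (1 + d) rho equals d (2 - rho), which is positive. *)
pose d := (1 - rho) / 2; have d0 : 0 < d by rewrite divr_gt0// subr_gt0.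
have dr : 0 < 1 - (1 + d) * rho.
  rewrite (_ : _ - _ = d * (2 - rho)); last by rewrite /d; field.
  by rewrite mulr_gt0// subr_gt0 (lt_trans r1)// ltr1n.
have [D D0 hD] : exists2 D, 0 <= D & (1 + d^-1) + (1 + d) * (rho * D) = D.
  exists ((1 + d^-1) / (1 - (1 + d) * rho)).
    apply: divr_ge0; last exact: ltW.
    by apply: addr_ge0 => //; rewrite invr_ge0; exact: ltW.
  by field; rewrite !gt_eqF.
exists D => // f C fC.
have hp n : ell2_le (partial f n) (D * C).
  elim: n => [|n IH].
    move=> s us; rewrite big1 => [|u _]; last by rewrite /partial big_ord0 nsq0.
    exact: mulr_ge0 D0 (ell2_le_ge0 fC).
  rewrite partialS -hD mulrDl -!mulrA.
  by apply: ell2_leD => //; apply: step_contract.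
move=> s us.
have cv : (fun n => \sum_(u <- s) nsq (partial f n u)) @ \oo -->
    \sum_(u <- s) nsq (neumann f u).
  elim: (s) => [|u t IH].
    by under eq_fun do rewrite big_nil; rewrite big_nil; exact: cvg_cst.
  under eq_fun do rewrite big_cons; rewrite big_cons; apply: cvgD => //.
  by apply: ccvg_nsq; apply: neumann_cvg; apply/ell2P; exists C.
rewrite -(cvg_lim _ cv)//; apply: limr_le.
  by apply/cvg_ex; eexists; exact: cv.
by apply: nearW => n; exact: hp.
Qed.

(** The hypothesis says that the imaginary part of the potential is constant, so T = [hop p] is
    normal: T T* = T* T. The inverse is S = T* G with G the inverse of the Gram operator,
    [neumann / K]. Normality makes S a right inverse, and injectivity of T makes it a left inverse;
    a lower bound on T alone therefore suffices. *)
Lemma bounded_below_invertible :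
  (forall u v, p u - (p u)^*%C = p v - (p v)^*%C) ->
  exists2 S, bounded_operator S &
    forall psi, ell2 psi -> S (hop p psi) = psi /\ hop p (S psi) = psi.
Proof.
move=> pIm; have [D D0 hD] := neumann_bound.
pose Ki : R[i] := ((K^-1)%:C)%C.
have KiK : Ki * (K%:C)%C = 1 by rewrite /Ki -rmorphM /= mulVf ?gt_eqF.
have pB' u : nsq (conjf p u) <= B by rewrite nsqJ.
pose S f := hop (conjf p) (fun u => Ki * neumann f u).
have hop_ell2 r : (forall u, nsq (r u) <= B) ->
    forall psi, ell2 psi -> ell2 (hop r psi).
  move=> rB psi /ell2P[C hC]; apply/ell2P; eexists; exact: hop_bound B0 rB hC.
have S_le f C : ell2_le f C ->
    ell2_le (S f) (4 * (3 + B) * (nsq Ki * (D * C))).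
  by move=> fC; apply: hop_bound => //; apply: ell2_leZ; exact: hD.
have S_ell2 f : ell2 f -> ell2 (S f).
  by move=> /ell2P[C fC]; apply/ell2P; eexists; exact: S_le fC.
have commute phi : hop p (hop (conjf p) phi) = gram phi.
  apply/funext => u; rewrite /gram /hop /conjf.
  have E (f : I -> I) : (p (f u))^*%C = p (f u) - (p u - (p u)^*%C).
    by rewrite (pIm u (f u)) subKr.
  by rewrite (E a) (E b) (E c); ring.
have right psi : ell2 psi -> hop p (S psi) = psi.
  move=> lpsi; rewrite /S commute; apply/funext => u.
  have -> : gram (fun u => Ki * neumann psi u) u = Ki * gram (neumann psi) u.
    by rewrite /gram /hop; ring.
  by rewrite gram_neumann// mulrA KiK mul1r.
(* A null vector is fixed by [step], whose iterates contract to 0. *)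
have inj psi : ell2 psi -> hop p psi = (fun=> 0) -> psi = fun=> 0.
  move=> /ell2P[C hC] h0.
  have stp : step psi = psi.
    apply/funext => u; rewrite /step /gram h0 /hop !mulr0 !addr0 mulr0 subr0 //.
  have itn n : iter n step psi = psi by elim: n => //= n ->.
  apply/funext => u; apply: (ccvg_unique (x := fun=> psi u)).
    by split; exact: cvg_cst.
  apply: (@ccvg_geometric0 _ _ rho C rho01) => n.
  by rewrite -{1}(itn n); exact: ell2_le_pt (iter_step_le n hC).
exists S; last first.
  move=> psi lpsi; split; last exact: right.
  have lh := hop_ell2 p pB psi lpsi.
  have l1 : ell2 (fun u => -1 * S (hop p psi) u + psi u).
    move/ell2P: (S_ell2 _ lh) => [C1 h1]; move/ell2P: lpsi => [C2 h2].
    by apply/ell2P; eexists; exact: (ell2_leD ltr01 (ell2_leZ (-1) h1) h2).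
  have := inj _ l1; have -> : hop p (fun u => -1 * S (hop p psi) u + psi u) = fun=> 0.
    by apply/funext => u; rewrite hopZD right// mulN1r addNr.
  move=> /(_ erefl) E; apply/funext => u.
  have := congr1 (fun f => f u) E; rewrite /= mulN1r addrC => /eqP.
  by rewrite subr_eq0 => /eqP.
split=> [|k f g lf lg|]; first exact: S_ell2.
- apply/funext => u; rewrite /S -hopZD; congr (hop _ _ u).
  by apply/funext => v; rewrite neumann_linear//; ring.
- exists (Num.sqrt (4 * (3 + B) * (nsq Ki * D))) => f lf.
  have f0 : 0 <= ell2_norm f by exact: sqrtr_ge0.
  apply: ell2_norm_le; first by rewrite mulr_ge0// sqrtr_ge0.
  rewrite exprMn sqr_sqrtr; last first.
    by rewrite !mulr_ge0 ?nsq_ge0// addr_ge0.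
  by rewrite -!mulrA mulrA; exact: S_le (ell2_le_norm lf).
Qed.

End Inverse.
End ThreeHops.

(** * Resolvent set and approximate eigenvectors *)

Section Schrodinger.
Variables (R : realType) (I : choiceType) (a b c : I -> I).
Hypotheses (aK : involutive a) (bK : involutive b) (cK : involutive c).
Variables (q : I -> R) (Q : R).
Hypothesis qQ : forall u, `|q u| <= Q.
Implicit Types (psi phi : I -> R[i]) (s : seq I) (z : R[i]).

Definition schr psi u : R[i] :=
  psi (a u) + psi (b u) + psi (c u) + ((q u)%:C)%C * psi u.

Definition pot z u : R[i] := ((q u)%:C)%C - z.

Lemma schr_shift z psi : shift_operator schr z psi = hop a b c (pot z) psi.
Proof. by apply/funext => u; rewrite /shift_operator /schr /hop /pot; ring. Qed.

Lemma pot_bound z u : nsq (pot z u) <= 2 * (Q ^+ 2 + nsq z).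
Proof.
apply: le_trans (nsqB _ _) _; rewrite ler_pM2l// lerD2r nsq_real.
by rewrite -real_normK ?num_real// ler_sqr ?nnegrE// (le_trans _ (qQ u)).
Qed.

Lemma conj_pot z u : ((pot z u)^*)%C = ((q u)%:C)%C - (z^*)%C.
Proof.
case: z => x y; apply/eqP; rewrite eq_complex /=.
by apply/andP; split; apply/eqP; ring.
Qed.

Lemma resolvent_below z (e : R) : 0 < e ->
  (forall s psi, uniq s -> supp_in s psi -> supp_in s (shift_operator schr z psi) ->
    e * \sum_(u <- s) nsq (psi u) <= \sum_(u <- s) nsq (shift_operator schr z psi u)) ->
  resolvent_set schr z.
Proof.
move=> e0 low.
have B0 : 0 <= 2 * (Q ^+ 2 + nsq z).
  by rewrite mulr_ge0// addr_ge0 ?sqr_ge0 ?nsq_ge0.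
have low' s psi : uniq s -> supp_in s psi -> supp_in s (hop a b c (pot z) psi) ->
    e * \sum_(u <- s) nsq (psi u) <= \sum_(u <- s) nsq (hop a b c (pot z) psi u).
  by rewrite -schr_shift; exact: low.
have [u v|S bS hS] := bounded_below_invertible aK bK cK B0 (pot_bound z) e0 low'.
  by rewrite !conj_pot /pot; ring.
by exists S => // psi; rewrite !schr_shift; exact: hS.
Qed.

Lemma schr_inner_real s psi : uniq s -> supp_in s psi ->
  complex.Im (\sum_(u <- s) (psi u)^*%C * schr psi u) = 0.
Proof.
move=> us hs; set X := \sum_(u <- s) _.
have E0 : X = \sum_(u <- s) (schr psi u)^*%C * psi u.
  rewrite /X (hop_adjoint aK bK cK (fun u => (q u)%:C)%C us hs hs).
  by apply: eq_bigr => u _; rewrite /hop /conjf conjc_real.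
have E : X = (X^*)%C.
  rewrite {1}E0 /X rmorph_sum; apply: eq_bigr => u _.
  by rewrite rmorphM /= conjcK mulrC.
move: E; clear E0; case: X => x y [] /= /eqP; rewrite -subr_eq0 opprK => /eqP h.
by apply/eqP; rewrite -[y == 0](@mulrn_eq0 R y 2) mulr2n h.
Qed.

Lemma resolvent_nonreal z : complex.Im z != 0 -> resolvent_set schr z.
Proof.
move=> z0; apply: (@resolvent_below z (complex.Im z ^+ 2)).
  by rewrite exprn_even_gt0.
move=> s psi us h1 h2; set y := complex.Im z.
have E : complex.Im (\sum_(u <- s) (psi u)^*%C * shift_operator schr z psi u)
         = - y * \sum_(u <- s) nsq (psi u).
  have -> : \sum_(u <- s) (psi u)^*%C * shift_operator schr z psi u =
    \sum_(u <- s) (psi u)^*%C * schr psi u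
    - z * ((\sum_(u <- s) nsq (psi u))%:C)%C.
    rewrite rmorph_sum /= mulr_sumr -sumrB; apply: eq_bigr => u _.
    by rewrite nsqE /shift_operator; ring.
  move: (schr_inner_real us h1); set X := \sum_(u <- s) _ * _ => h.
  move: h; case: X => x1 x2 /= ->; rewrite /y; case: (z) => z1 z2 /=; ring.
have ImS (F : I -> R[i]) : complex.Im (\sum_(u <- s) F u) = \sum_(u <- s) complex.Im (F u).
  by apply: (big_morph (@complex.Im R)) => //; case=> ? ? [].
(* A pointwise arithmetic-geometric inequality takes the place of Cauchy-Schwarz: the left side sums
   to 2 y^2 N by [E], with N the sum of [nsq (psi u)], so y^2 N is at most the sum on the right that
   involves the operator. *)
have : \sum_(u <- s) (- 2 * y * complex.Im ((psi u)^*%C * shift_operator schr z psi u))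
   <= \sum_(u <- s) (y ^+ 2 * nsq (psi u) + nsq (shift_operator schr z psi u)).
  apply: ler_sum => u _; case: (psi u) => x1 x2.
  case: (shift_operator _ _ _ _) => w1 w2; rewrite /nsq /=.
  have := sqr_ge0 (y * x1 + w2); have := sqr_ge0 (y * x2 - w1); lra.
rewrite -mulr_sumr -ImS E [leRHS]big_split /= -mulr_sumr.
set N := \sum_(u <- s) nsq (psi u); set M := \sum_(u <- s) nsq _; lra.
Qed.

(** Weyl's criterion, easy direction: a bounded inverse of norm at most |M| cannot coexist with
    vectors that the shifted operator shrinks by more than the factor 1 / |M|. *)
Lemma spectrum_approx z :
  (forall e : R, 0 < e -> exists psi, [/\ ell2 psi, (exists u, psi u != 0) &
     forall C, ell2_le psi C -> ell2_le (shift_operator schr z psi) (e * C)]) ->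
  spectrum schr z.
Proof.
move=> h [S [_ _ [M hM]] hS].
(* Any [e] with M^2 e < 1 would contradict the norm bound; adding 1 also covers M = 0. *)
have e0 : 0 < (M ^+ 2 + 1)^-1 :> R by rewrite invr_gt0 ltr_wpDl ?sqr_ge0.
have [psi [lpsi [u pu] hpsi]] := h _ e0.
set e := (M ^+ 2 + 1)^-1 in e0 hpsi.
have lT := hpsi _ (ell2_le_norm lpsi).
have lT2 : ell2 (shift_operator schr z psi) by apply/ell2P; eexists; exact: lT.
have n0 : 0 < ell2_norm psi.
  rewrite lt_neqAle sqrtr_ge0 andbT eq_sym; apply: contra pu => /eqP n0.
  have := ell2_le_pt u (ell2_le_norm lpsi); rewrite n0 expr0n /= => h0.
  by rewrite -nsq_eq0 eq_le h0 nsq_ge0.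
have h1 : ell2_norm (shift_operator schr z psi) <= Num.sqrt e * ell2_norm psi.
  apply: ell2_norm_le; first by rewrite mulr_ge0// sqrtr_ge0.
  by rewrite exprMn sqr_sqrtr// ltW.
have := hM _ lT2; rewrite (hS _ lpsi).1 => h2.
have h3 : ell2_norm psi ^+ 2 <= M ^+ 2 * (e * ell2_norm psi ^+ 2).
  have -> : M ^+ 2 * (e * ell2_norm psi ^+ 2) = (`|M| * (Num.sqrt e * ell2_norm psi)) ^+ 2.
    by rewrite !exprMn (sqr_sqrtr (ltW e0)) real_normK ?num_real.
  rewrite ler_sqr ?nnegrE ?(ltW n0)//; last by rewrite !mulr_ge0 ?sqrtr_ge0// ltW.
  apply: le_trans h2 _; apply: le_trans (_ : `|M| * ell2_norm (shift_operator schr z psi) <= _).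
    by rewrite ler_wpM2r ?sqrtr_ge0// ler_norm.
  by rewrite ler_wpM2l.
move: h3; rewrite mulrA -[X in X <= _]mul1r ler_pM2r ?exprn_gt0//.
by rewrite /e ler_pdivlMr ?ltr_wpDl ?sqr_ge0// mul1r gerDl ler10.
Qed.

(* Slowly varying weights chi turn a bounded generalized eigenfunction into an
   approximate eigenvector, with error controlled by chi (f u) / chi u - 1 for the hops f. *)
Lemma spectrum_bloch z :
  (forall e : R, 0 < e -> exists (w : R[i]) (Psi : I -> R[i]),
     [/\ nsq (w - z) <= e, (exists B, forall u, nsq (Psi u) <= B), (exists u, Psi u != 0) &
         schr Psi =1 (fun u => w * Psi u)]) ->
  (forall e : R, 0 < e -> exists chi : I -> R,
     [/\ (forall u, 0 < chi u), ell2 (fun u => (chi u)%:C)%C &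
         forall u, [/\ chi (a u) <= (1 + e) * chi u, chi (b u) <= (1 + e) * chi u
                     & chi (c u) <= (1 + e) * chi u]]) ->
  spectrum schr z.
Proof.
move=> hw hchi; apply: spectrum_approx => e e0.
(* The error has four terms, hence a factor 4: three hops contribute d^2 each, and the energy
   mismatch [w - z] contributes d. *)
have [d d0 de] : exists2 d : R, 0 < d & 12 * d ^+ 2 + 4 * d <= e.
  exists (Num.min 1 (e / 16)); first by rewrite lt_min ltr01 divr_gt0.
  set d := Num.min _ _.
  have d1 : d <= 1 by rewrite ge_min lexx.
  have d2 : d <= e / 16 by rewrite ge_min lexx orbT.
  have d0 : 0 <= d by rewrite le_min ler01 divr_ge0// ltW.
  have : d * d <= 1 * d by rewrite ler_wpM2r.
  by rewrite expr2; lra.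
have [w [Psi [wz [B PB] [u0 Pu0] HPsi]]] := hw _ d0.
have [chi [chi0 lchi hc]] := hchi _ d0.
exists (fun u => ((chi u)%:C)%C * Psi u); split.
- have B0 : 0 <= B by exact: le_trans (nsq_ge0 _) (PB u0).
  move/ell2P: lchi => [C hC]; apply/ell2P; exists (B * C) => s us.
  apply: le_trans (_ : B * (\sum_(u <- s) nsq ((chi u)%:C)%C) <= _).
    rewrite mulr_sumr; apply: ler_sum => u _.
    by rewrite nsqM mulrC ler_wpM2r ?nsq_ge0.
  by rewrite ler_wpM2l// hC.
- exists u0; rewrite mulf_neq0// -nsq_eq0 nsq_real sqrf_eq0 gt_eqF//.
move=> C hC; set psi := fun u => _ * _ in hC *.
(* The growth condition used at [u] and at [f u] controls the ratio of neighboring weights from both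
   sides, because [f] is an involution. *)
have dif (f : I -> I) u : involutive f -> (forall v, chi (f v) <= (1 + d) * chi v) ->
   nsq ((chi (f u) - chi u)%:C%C * Psi (f u)) <= d ^+ 2 * nsq (psi (f u)).
  move=> fK hf; rewrite /psi !nsqM mulrA ler_wpM2r ?nsq_ge0// !nsq_real -exprMn.
  have h1 := hf u; have := hf (f u); rewrite fK => h2.
  have c0 := chi0 u; have c1 := chi0 (f u).
  have : d * chi u <= d * ((1 + d) * chi (f u)) by rewrite ler_pM2l.
  have dc : 0 <= d * chi (f u) by rewrite mulr_ge0 ?ltW.
  move=> h3; rewrite -[leLHS]real_normK ?num_real// ler_sqr ?nnegrE//.
  rewrite ler_norml; apply/andP; split; last first.
    have [h|h] := leP (chi (f u)) (chi u).
      by apply: (@le_trans _ _ 0); rewrite ?subr_le0// mulr_ge0 ?ltW.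
    apply: (@le_trans _ _ (d * chi u)); first by lra.
    by rewrite ler_pM2l// ltW.
  lra.
have key u : nsq (shift_operator schr z psi u) <=
    4 * (d ^+ 2 * (nsq (psi (a u)) + nsq (psi (b u)) + nsq (psi (c u))) + d * nsq (psi u)).
  have -> : shift_operator schr z psi u =
     (chi (a u) - chi u)%:C%C * Psi (a u) + (chi (b u) - chi u)%:C%C * Psi (b u)
     + (chi (c u) - chi u)%:C%C * Psi (c u) + (w - z) * psi u.
    rewrite /shift_operator /schr /psi !rmorphB /=.
    have -> : (w - z) * ((chi u)%:C%C * Psi u) =
       (chi u)%:C%C * (w * Psi u) - z * ((chi u)%:C%C * Psi u) by ring.
    by rewrite -HPsi /schr; ring.
  apply: le_trans (@nsqD_weighted _ 3 _ _ (ltr0n R 3)) _.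
  have := nsqD3 ((chi (a u) - chi u)%:C%C * Psi (a u))
    ((chi (b u) - chi u)%:C%C * Psi (b u)) ((chi (c u) - chi u)%:C%C * Psi (c u)).
  have := dif a u aK (fun v => let: And3 h _ _ := hc v in h).
  have := dif b u bK (fun v => let: And3 _ h _ := hc v in h).
  have := dif c u cK (fun v => let: And3 _ _ h := hc v in h).
  have : nsq ((w - z) * psi u) <= d * nsq (psi u).
    by rewrite nsqM ler_wpM2r ?nsq_ge0.
  lra.
move=> s us; apply: le_trans (ler_sum _ (fun u _ => key u)) _.
rewrite -mulr_sumr big_split /= -!mulr_sumr 2!big_split /=.
have h (f : I -> I) : involutive f -> \sum_(u <- s) nsq (psi (f u)) <= C.
  by move=> /inv_inj fI; apply: (ell2_le_inj fI hC).
have C0 := ell2_le_ge0 hC.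
apply: le_trans (_ : (12 * d ^+ 2 + 4 * d) * C <= _); last by rewrite ler_wpM2r.
have := h a aK; have := h b bK; have := h c cK; have := hC s us.
set X1 := \sum_(u <- s) _; set X2 := \sum_(u <- s) _.
set X3 := \sum_(u <- s) _; set X4 := \sum_(u <- s) _.
move=> h1 h2 h3 h4.
have g1 : d * X1 <= d * C by rewrite ler_pM2l.
have g2 : d ^+ 2 * (X4 + X3 + X2) <= d ^+ 2 * (3 * C).
  by rewrite ler_pM2l ?exprn_gt0//; lra.
by lra.
Qed.

End Schrodinger.

(** * Coordinates on the hexagonal lattice *)

Section Transport.
Variables (R : realType) (I J : choiceType) (f : J -> I) (g : I -> J).
Hypotheses (fK : cancel f g) (gK : cancel g f).

Lemma ell2_normsq_comp (psi : I -> R[i]) :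
  ell2_normsq (psi \o f) = ell2_normsq psi.
Proof.
rewrite /ell2_normsq (@reindex_esum _ J I [set: J] [set: I] f)//.
  split=> // [x y _ _ /(congr1 g)|x _]; first by rewrite !fK.
  by exists (g x).
Qed.

Lemma ell2_comp (psi : I -> R[i]) : ell2 (psi \o f) <-> ell2 psi.
Proof. by rewrite /ell2 /= ell2_normsq_comp. Qed.

Lemma ell2_norm_comp (psi : I -> R[i]) : ell2_norm (psi \o f) = ell2_norm psi.
Proof. by rewrite /ell2_norm ell2_normsq_comp. Qed.
End Transport.

Section TransportSpectrum.
Variables (R : realType).

Lemma resolvent_transport (I J : choiceType) (f : J -> I) (g : I -> J)
  (T : (I -> R[i]) -> (I -> R[i])) (T' : (J -> R[i]) -> (J -> R[i])) (z : R[i]) :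
  cancel f g -> cancel g f -> (forall psi, T psi \o f = T' (psi \o f)) ->
  resolvent_set T z -> resolvent_set T' z.
Proof.
move=> fK gK TT' [S [S1 S2 [M S3]] S4].
have fgE (psi : J -> R[i]) : (psi \o g) \o f = psi.
  by apply/funext => j; rewrite /= fK.
have lg (psi : J -> R[i]) : ell2 psi -> ell2 (psi \o g)
  by move=> h; apply: (proj1 (ell2_comp fK gK _)); rewrite fgE.
exists (fun psi => S (psi \o g) \o f).
  split=> [psi h|a phi psi h1 h2|]; first exact: (proj2 (ell2_comp fK gK _)) (S1 _ (lg _ h)).
    have := S2 a (phi \o g) (psi \o g) (lg _ h1) (lg _ h2).
    by rewrite /comp => ->.
  exists M => psi h; rewrite (ell2_norm_comp fK gK).
  by have := S3 _ (lg _ h); rewrite -(ell2_norm_comp fK gK (psi \o g)) fgE.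
move=> psi h; have [h1 h2] := S4 _ (lg _ h).
have sh (phi : I -> R[i]) : shift_operator T z phi \o f = shift_operator T' z (phi \o f).
  by apply/funext => j; rewrite /shift_operator -TT'.
split.
  have -> : shift_operator T' z psi \o g = shift_operator T z (psi \o g).
    rewrite -[in LHS](fgE psi) -sh; apply/funext => i; by rewrite /= gK.
  by rewrite h1 fgE.
by rewrite -sh h2 fgE.
Qed.

Lemma spectrum_transport (I J : choiceType) (f : J -> I) (g : I -> J)
  (T : (I -> R[i]) -> (I -> R[i])) (T' : (J -> R[i]) -> (J -> R[i])) :
  cancel f g -> cancel g f -> (forall psi, T psi \o f = T' (psi \o f)) ->
  spectrum T = spectrum T'.
Proof.
move=> fK gK TT'; apply/seteqP; split=> z /= h; apply: contra_not h.
  apply: (resolvent_transport gK fK) => psi.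
  have -> : psi = (psi \o g) \o f by apply/funext => j; rewrite /= fK.
  rewrite -TT'; apply/funext => i; rewrite /= gK.
  by congr (T _ _); apply/funext => x; rewrite /= gK.
exact: (resolvent_transport fK gK).
Qed.
End TransportSpectrum.

Lemma eisenstein_int_eq0 (x y : int) : x ^+ 2 + x * y + y ^+ 2 = 0 -> x = 0 /\ y = 0.
Proof.
move=> h; have := sqr_ge0 (2 * x + y); have := sqr_ge0 (2 * y + x).
have := sqr_ge0 x; have := sqr_ge0 y => y2 x2 h1 h2.
by split; apply/eqP; rewrite -sqrf_eq0; apply/eqP; lia.
Qed.

(** Four times the form is (2x + y + 1)^2 + (3y - 1)(y + 1), so y is 0 or -1; by symmetry the same
    holds for x, and x = y = -1 is not a solution. *)
Lemma eisenstein_int_neighbors (x y : int) : x ^+ 2 + x * y + y ^+ 2 + x + y = 0 ->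
    [\/ x = 0 /\ y = 0, x = -1 /\ y = 0 | x = 0 /\ y = -1].
Proof.
have bnd (u v : int) : u ^+ 2 + u * v + v ^+ 2 + u + v = 0 -> v = 0 \/ v = -1.
  move=> h; have := sqr_ge0 (2 * u + v + 1).
  by have := sqr_ge0 (v - 1); have := sqr_ge0 (v + 2); lia.
move=> h; have [] := bnd _ _ h; have : y ^+ 2 + y * x + x ^+ 2 + y + x = 0 by lia.
  by move=> /bnd[->|->] ->; [constructor 1|constructor 2].
move=> /bnd[->|E'] E; first by constructor 3.
by move: h; rewrite E E'.
Qed.

Section HexCoordinates.
Variable R : realType.

Definition site : Type := (int * int * bool)%type.
HB.instance Definition _ := Choice.on site.

(* The three edges at a vertex: [false] marks the vertices [n b_+ + m b_-] and
   [true] their translates by [a_1]. *)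
Definition hop0 (u : site) : site := (u.1.1, u.1.2, ~~ u.2).
Definition hop1 (u : site) : site :=
  ((if u.2 then u.1.1 + 1 else u.1.1 - 1), u.1.2, ~~ u.2).
Definition hop2 (u : site) : site :=
  (u.1.1, (if u.2 then u.1.2 + 1 else u.1.2 - 1), ~~ u.2).

Lemma hop0K : involutive hop0. Proof. by case=> [[n m] []]. Qed.
Lemma hop1K : involutive hop1.
Proof. by case=> [[n m] []]; rewrite /hop1 /= ?addrK ?subrK. Qed.
Lemma hop2K : involutive hop2.
Proof. by case=> [[n m] []]; rewrite /hop2 /= ?addrK ?subrK. Qed.

Definition hex_point (u : site) : R * R :=
  (if u.2 then hex_a1 R else 0) + hex_bp R *~ u.1.1 + hex_bm R *~ u.1.2.

Lemma hex_pointP u : Vhex R (hex_point u).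
Proof.
case: u => [[n m] []]; [right|left]; exists (n, m) => //=.
by rewrite /hex_point /= add0r.
Qed.

Definition hex_vertex (u : site) : Vhex R := SigSub (mem_set (hex_pointP u)).

Lemma val_hex_vertex u : \val (hex_vertex u) = hex_point u. Proof. by []. Qed.

Lemma hex_point1 (u : site) :
  (hex_point u).1 = u.2%:R + 3 / 2 * (u.1.1%:~R + u.1.2%:~R).
Proof.
have E (x : R * R) (k : int) : (x *~ k).1 = x.1 *~ k by exact: (raddfMz fst).
case: u => [[n m] t]; rewrite /hex_point /= !E /= -(mulrzl (3 / 2)) -(mulrzl (3 / 2) m).
by case: t => /=; ring.
Qed.

Lemma hex_point2 (u : site) :
  (hex_point u).2 = Num.sqrt 3 / 2 * (u.1.1%:~R - u.1.2%:~R).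
Proof.
have E (x : R * R) (k : int) : (x *~ k).2 = x.2 *~ k by exact: (raddfMz snd).
case: u => [[n m] t]; rewrite /hex_point /= !E /=.
rewrite -(mulrzl (Num.sqrt 3 / 2)) -(mulrzl (- (Num.sqrt 3 / 2))).
by case: t => /=; ring.
Qed.

(** The square roots cancel, so adjacency becomes a Diophantine condition on the coordinates. *)
Lemma hex_distsq (u v : site) :
  ((hex_point u).1 - (hex_point v).1) ^+ 2 + ((hex_point u).2 - (hex_point v).2) ^+ 2
  = (let e := (u.2%:R - v.2%:R) in let x := u.1.1 - v.1.1 in let y := u.1.2 - v.1.2 in
     e ^+ 2 + 3 * (e * (x + y) + x ^+ 2 + x * y + y ^+ 2) : int)%:~R.
Proof.
rewrite !hex_point1 !hex_point2; case: u v => [[n m] t] [[n' m'] t'] /=.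
have s3 : Num.sqrt 3 ^+ 2 = 3 :> R by rewrite sqr_sqrtr.
rewrite !(rmorphD, rmorphM, rmorphXn, rmorphB) /=.
have -> (s : bool) : (s%:R : int)%:~R = s%:R :> R by case: s.
by field: s3.
Qed.

Lemma hex_vertex_inj : injective hex_vertex.
Proof.
move=> u v /(congr1 val) /= E; have := hex_distsq u v.
rewrite E !subrr expr0n addr0 => /esym/eqP; rewrite intr_eq0 => /eqP /=.
case: u v {E} => [[n m] t] [[n' m'] t'] /=.
have eq0 : (n - n') ^+ 2 + (n - n') * (m - m') + (m - m') ^+ 2 = 0 ->
    (n, m, t) = (n', m', t).
  by move=> /eisenstein_int_eq0[h1 h2]; congr (_, _, _); lia.
case: t t' eq0 => [] [] /= eq0 h; last 2 first.
- by exfalso; lia.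
- by apply: eq0; lia.
- by apply: eq0; lia.
- by exfalso; lia.
Qed.

Lemma hex_vertex_surj (v : Vhex R) : exists u, hex_vertex u = v.
Proof.
case: v => x hx; have := set_mem hx; case=> -[[n m] _ E].
  exists (n, m, false); apply/val_inj; rewrite /= -E /hex_point /=.
  by rewrite add0r.
by exists (n, m, true); apply/val_inj; rewrite /= -E.
Qed.

(** Within one sublattice the squared distance is a multiple of 3, so it is never 1; between the two
    sublattices the equation is the one solved in [eisenstein_int_neighbors]. *)
Lemma hex_neighbors_vertex (u : site) : hex_neighbors (hex_vertex u) =
  [set` [:: hex_vertex (hop0 u); hex_vertex (hop1 u); hex_vertex (hop2 u)]].
Proof.
have dist1 v : euclidean_dist (\val (hex_vertex u)) (\val (hex_vertex v)) = 1 <->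
    v \in [:: hop0 u; hop1 u; hop2 u].
  rewrite /euclidean_dist !val_hex_vertex hex_distsq.
  have E (k : int) : Num.sqrt (k%:~R : R) = 1 <-> k = 1.
    split=> [h|->]; last by rewrite sqrtr1.
    have [k0|k0] := leP 0 k; last first.
      move: h; rewrite ler0_sqrtr; last by rewrite lerz0 ltW.
      by move/eqP; rewrite eq_sym oner_eq0.
    have : (k%:~R : R) = 1 by rewrite -[LHS]sqr_sqrtr ?ler0z// h expr1n.
    by move/eqP; rewrite (eqr_int R k 1) => /eqP.
  apply: (iff_trans (E _)).
  case: u v => [[n m] t] [[n' m'] t'] /=; rewrite /hop0 /hop1 /hop2 !inE.
  rewrite !xpair_eqE /=; case: t; case: t' => /=; rewrite ?andbF ?andbT ?orbF.
  - by split=> // h; exfalso; lia.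
  - split=> [h|].
      have /eisenstein_int_neighbors : (n - n') ^+ 2 + (n - n') * (m - m')
          + (m - m') ^+ 2 + (n - n') + (m - m') = 0 by lia.
      case=> -[h1 h2]; apply/or3P; [constructor 1|constructor 2|constructor 3];
        apply/andP; split; apply/eqP; lia.
    by case/or3P => /andP[/eqP-> /eqP->]; ring.
  - split=> [h|].
      have /eisenstein_int_neighbors : (n' - n) ^+ 2 + (n' - n) * (m' - m)
          + (m' - m) ^+ 2 + (n' - n) + (m' - m) = 0 by lia.
      case=> -[h1 h2]; apply/or3P; [constructor 1|constructor 2|constructor 3];
        apply/andP; split; apply/eqP; lia.
    by case/or3P => /andP[/eqP-> /eqP->]; ring.
  - by split=> // h; exfalso; lia.
apply/seteqP; split => w /=; have [v <-] := hex_vertex_surj w.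
  by move/dist1; rewrite !inE => /or3P[] /eqP->; rewrite eqxx ?orbT.
rewrite !inE !(inj_eq hex_vertex_inj) => h; apply/dist1.
by rewrite !inE.
Qed.

Lemma hex_laplacian_vertex psi u : hex_laplacian psi (hex_vertex u) =
  psi (hex_vertex (hop0 u)) + psi (hex_vertex (hop1 u)) + psi (hex_vertex (hop2 u)).
Proof.
rewrite /hex_laplacian hex_neighbors_vertex -fsbig_seq; last first.
  have : uniq (map hex_vertex [:: hop0 u; hop1 u; hop2 u]) by
    rewrite (map_inj_uniq hex_vertex_inj); case: u => [[n m] []];
    rewrite /hop0 /hop1 /hop2 /= !inE !xpair_eqE /=; lia.
  by [].
by rewrite !big_cons big_nil /= addr0 addrA.
Qed.

Lemma hex_spectrum (Q : Vhex R -> R) :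
  spectrum (hex_schrodinger Q) = spectrum (schr hop0 hop1 hop2 (Q \o hex_vertex)).
Proof.
have [g gP] := choice hex_vertex_surj.
have fK : cancel hex_vertex g by move=> u; apply: hex_vertex_inj; rewrite gP.
apply: (spectrum_transport fK gP) => psi; apply/funext => u.
by rewrite /= /hex_schrodinger hex_laplacian_vertex.
Qed.

End HexCoordinates.

(** * Fourier analysis *)

Section Boxes.
Variable R : realType.

(** The integers from -M to M - 1, since [Negz i] is -(i + 1). *)
Definition intbox (M : nat) : seq int :=
  [seq Posz i | i <- iota 0 M] ++ [seq Negz i | i <- iota 0 M].

Lemma mem_intbox M (n : int) : (n \in intbox M) = ((Negz M < n) && (n < M%:Z)).
Proof.
rewrite mem_cat; case: n => n.
  rewrite mem_map; last by move=> x y [].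
  rewrite mem_iota add0n leq0n /= orbC.
  case: mapP => [[x _ //]|_] /=; lia.
rewrite orbC mem_map; last by move=> x y [].
rewrite mem_iota add0n leq0n /= orbC.
case: mapP => [[x _ //]|_] /=; lia.
Qed.

Lemma intbox_uniq M : uniq (intbox M).
Proof.
rewrite cat_uniq !map_inj_uniq ?iota_uniq//=; try by move=> x y [].
by rewrite andbT; apply/hasPn => x /mapP[i _ ->]; apply/mapP => -[].
Qed.

Definition box (M : nat) : seq site :=
  [seq (x, t) | x <- [seq (n, m) | n <- intbox M, m <- intbox M],
                t <- [:: false; true]].

Lemma mem_box M u :
  (u \in box M) = (u.1.1 \in intbox M) && (u.1.2 \in intbox M).
Proof.
case: u => [[n m] t] /=; apply/allpairsP/andP => [[[x t'] /= [h _ [E _]]]|[h1 h2]].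
  by move: h; rewrite -E => /allpairsP[[n' m'] /= [h1 h2 [-> ->]]].
exists ((n, m), t); split=> //=; last by case: t.
by apply/allpairsP; exists (n, m).
Qed.

Lemma box_uniq M : uniq (box M).
Proof.
apply: allpairs_uniq => //; last by move=> [? ?] [? ?].
apply: allpairs_uniq; rewrite ?intbox_uniq//; by move=> [? ?] [? ?].
Qed.

Lemma sum_box (V : nmodType) M (f : site -> V) : \sum_(u <- box M) f u =
  \sum_(n <- intbox M) \sum_(m <- intbox M) \sum_(t : bool) f (n, m, t).
Proof.
rewrite /box big_allpairs big_allpairs; apply: eq_bigr => n _.
by apply: eq_bigr => m _; rewrite big_bool /= !big_cons big_nil addr0 addrC.
Qed.

Lemma sub_intbox M N : (M <= N)%N -> {subset intbox M <= intbox N}.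
Proof. by move=> MN n; rewrite !mem_intbox; lia. Qed.

Lemma sub_box M N : (M <= N)%N -> {subset box M <= box N}.
Proof.
move=> MN u; rewrite !mem_box => /andP[h1 h2].
by rewrite (sub_intbox MN h1) (sub_intbox MN h2).
Qed.

Lemma in_some_box (s : seq site) : exists M, {subset s <= box M}.
Proof.
elim: s => [|u s [M hM]]; first by exists 0%N.
exists (M + `|u.1.1| + `|u.1.2| + 1)%N => v; rewrite inE => /orP[/eqP->|/hM].
  by rewrite mem_box !mem_intbox; lia.
by apply: sub_box; lia.
Qed.

Lemma geometric_sum_le (r : R) n : 0 <= r < 1 ->
  \sum_(i <- iota 0 n) r ^+ i <= (1 - r)^-1.
Proof.
move=> /andP[r0 r1]; rewrite -{1}[n]subn0 -/(index_iota 0 n) big_mkord.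
rewrite -[leRHS]mul1r ler_pdivlMr ?subr_gt0//.
have := subrX1 r n; have := exprn_ge0 n r0; lra.
Qed.

Lemma intbox_geometric_le (r : R) M : 0 <= r < 1 ->
  \sum_(n <- intbox M) r ^+ `|n|%N <= 2 * (1 - r)^-1.
Proof.
move=> r01; have := geometric_sum_le M r01; have /andP[r0 r1] := r01.
rewrite big_cat !big_map /= => h.
have : \sum_(i <- iota 0 M) r ^+ `|Negz i|%N <= \sum_(i <- iota 0 M) r ^+ i.
  by apply: ler_sum => i _; rewrite /= exprS ler_piMl ?exprn_ge0// ltW.
lra.
Qed.

End Boxes.

Section HexWeyl.
Variables (R : realType) (q : site -> R).

Let weight (r : R) (u : site) : R := r ^+ (`|u.1.1| + `|u.1.2|)%N.

Lemma weight_ell2 r : 0 < r < 1 -> ell2 (fun u => (weight r u)%:C%C).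
Proof.
move=> /andP[r0 r1].
have r01 : 0 <= r ^+ 2 < 1 by rewrite exprn_ge0 ?ltW// exprn_ilt1 ?ltW.
pose G := 2 * (1 - r ^+ 2)^-1; apply/ell2P; exists (2 * (G * G)) => s us.
have [M sM] := in_some_box s.
apply: le_trans (ler_sum_sub us sM _) _; first by move=> u; exact: nsq_ge0.
rewrite sum_box.
have -> : \sum_(n <- intbox M) \sum_(m <- intbox M) \sum_(t : bool)
     nsq ((weight r (n, m, t))%:C)%C =
  2 * ((\sum_(n <- intbox M) (r ^+ 2) ^+ `|n|%N) *
       (\sum_(n <- intbox M) (r ^+ 2) ^+ `|n|%N)).
  rewrite mulr_suml mulr_sumr; apply: eq_bigr => n _.
  rewrite mulrCA mulr_sumr mulr_sumr; apply: eq_bigr => m _.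
  rewrite big_bool /= !nsq_real /weight /= exprD !(exprAC _ 2).
  by ring.
rewrite ler_pM2l//; have S0 : 0 <= \sum_(n <- intbox M) (r ^+ 2) ^+ `|n|%N.
  by apply: sumr_ge0 => n _; rewrite exprn_ge0// (andP r01).1.
by apply: ler_pM => //; exact: intbox_geometric_le.
Qed.

Lemma hex_spectrum_bloch z :
  (forall e : R, 0 < e -> exists (w : R[i]) (Psi : site -> R[i]),
     [/\ nsq (w - z) <= e, (exists B, forall u, nsq (Psi u) <= B), (exists u, Psi u != 0) &
         schr hop0 hop1 hop2 q Psi =1 (fun u => w * Psi u)]) ->
  spectrum (schr hop0 hop1 hop2 q) z.
Proof.
move=> h; refine (spectrum_bloch hop0K hop1K hop2K h _) => e e0.
have e1 : 0 < 1 + e by lra.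
have r01 : 0 < (1 + e)^-1 < 1 by rewrite invr_gt0 e1 invf_lt1//; lra.
(* A hop changes |n| + |m| by at most 1, so this exponential weight varies by a factor at most 1 +
   e. *)
exists (weight (1 + e)^-1); split=> [u||u].
- by rewrite exprn_gt0// invr_gt0.
- exact: weight_ell2.
have step j k : (j <= k.+1)%N -> (1 + e)^-1 ^+ k <= (1 + e) * (1 + e)^-1 ^+ j.
  move=> jk; rewrite -ler_pdivrMl// -exprS.
  by apply: ler_wiXn2l => //; rewrite ltW//; case/andP: r01.
case: u => [[n m] t]; rewrite /weight /hop0 /hop1 /hop2 /=.
by split; apply: step; case: t; lia.
Qed.

End HexWeyl.

Section Fourier.
Variable R : realType.
Local Notation C := R[i].

Lemma nsq_unit_neq0 (x : C) : nsq x = 1 -> x != 0.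
Proof. by move=> x1; rewrite -nsq_eq0 x1 oner_eq0. Qed.

Lemma nsq_unit_inv (x : C) : nsq x = 1 -> (x^*)%C = x^-1.
Proof.
move=> x1; have x0 := nsq_unit_neq0 x1; apply: (mulfI x0).
by rewrite -nsqE x1 divff.
Qed.

Lemma nsq_exp (x : C) n : nsq (x ^+ n) = nsq x ^+ n.
Proof.
elim: n => [|n IH]; last by rewrite !exprS nsqM IH.
by rewrite !expr0 /nsq /= expr0n addr0 expr1n.
Qed.

(* A 2^k-th root of -1 is a primitive root of unity of order 2^(k+1). *)
Lemma exists_root_of_unity (k : nat) : exists x : C,
  [/\ nsq x = 1, x ^+ (2 ^ k.+1) = 1 &
      forall d : nat, (0 < d < 2 ^ k.+1)%N -> x ^+ d != 1].
Proof.
have k0 : (0 < 2 ^ k)%N by rewrite expn_gt0.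
pose x : C := (2 ^ k).-root (-1).
have xk : x ^+ (2 ^ k) = -1 by rewrite rootCK.
have xk1 : x ^+ (2 ^ k.+1) = 1 by rewrite expnSr exprM xk sqrrN expr1n.
have nx : nsq x = 1.
  have : nsq x ^+ (2 ^ k) = 1.
    by rewrite -nsq_exp xk nsqN /nsq /= expr0n addr0 expr1n.
  by move/eqP; rewrite pexpr_eq1 ?nsq_ge0// => /eqP.
exists x; split=> // d /andP[d0 dk]; apply/eqP => xd.
have K0 : (0 < 2 ^ k.+1)%N by rewrite expn_gt0.
have [m pm mk] := prim_order_exists K0 xk1.
have md : (m %| d)%N by rewrite (prim_order_dvd pm) xd.
have [j jk mE] : exists2 j, (j <= k.+1)%N & m = (2 ^ j)%N.
  by move/(dvdn_pfactor _ _ (isT : prime 2)): mk.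
have : (m <= d)%N by apply: dvdn_leq.
move: jk; rewrite leq_eqVlt => /orP[/eqP jE|jk].
  by rewrite mE jE leqNgt dk.
have : x ^+ (2 ^ k) == 1 by rewrite -(prim_order_dvd pm) mE dvdn_exp2l.
by rewrite xk eqNr oner_eq0.
Qed.

Definition trig (s : seq int) (f : int -> C) (x : C) : C :=
  \sum_(n <- s) f n * x ^ n.

Lemma sum_exprz_unity (x : C) (K : nat) (d : int) : x != 0 -> x ^+ K = 1 ->
  x ^ d != 1 -> \sum_(j < K) (x ^+ j) ^ d = 0.
Proof.
move=> x0 xK xd; have : (x ^ d - 1) * \sum_(j < K) (x ^+ j) ^ d = 0.
  under eq_bigr => j _ do rewrite exprnP exprzAC -exprnP.
  by rewrite -subrX1 exprnP exprzAC -exprnP xK exp1rz subrr.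
by move/eqP; rewrite mulf_eq0 subr_eq0 (negPf xd) => /eqP.
Qed.

(** Orthogonality of characters on the powers of [x]: the last hypothesis keeps the exponents in [s]
    distinct modulo the order of [x], so every off-diagonal term is a vanishing geometric sum. *)
Lemma parseval (s : seq int) (K : nat) (x : C) : uniq s -> nsq x = 1 ->
  x ^+ K = 1 -> {in s &, forall n m, n != m -> x ^ (n - m) != 1} ->
  forall f, \sum_(j < K) nsq (trig s f (x ^+ j)) = K%:R * \sum_(n <- s) nsq (f n).
Proof.
move=> us x1 xK xs f; have x0 := nsq_unit_neq0 x1; apply: complexI.
rewrite rmorphM /= rmorph_nat !rmorph_sum /=.
under eq_bigr => j _ do rewrite nsqE /trig rmorph_sum big_distrlr.
rewrite exchange_big /= mulr_sumr big_seq [RHS]big_seq; apply: eq_bigr => n ns.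
rewrite exchange_big /= (bigD1_seq n)//= [X in _ + X]big1_seq ?addr0; last first.
  move=> m /andP[mn ms].
  under eq_bigr => j _.
    have -> : f n * (x ^+ j) ^ n * ((f m * (x ^+ j) ^ m)^*)%C =
        f n * (f m)^*%C * (x ^+ j) ^ (n - m).
      have xj1 : nsq (x ^+ j) = 1 by rewrite nsq_exp x1 expr1n.
      rewrite rmorphM /= expfzDr ?(nsq_unit_neq0 xj1)// -exprz_inv.
      have -> : (((x ^+ j) ^ m)^*)%C = ((x ^+ j)^-1) ^ m.
        rewrite -(nsq_unit_inv xj1); case: m {mn ms} => m; first by rewrite -!exprnP rmorphXn.
        by rewrite !NegzE -!exprnN conjc_inv rmorphXn.
      by ring.
    over.
  by rewrite -mulr_sumr sum_exprz_unity ?mulr0//; apply: xs; rewrite // eq_sym.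
rewrite (eq_bigr (fun=> (nsq (f n))%:C%C)); first by rewrite sumr_const card_ord mulr_natl.
move=> j _; rewrite -nsqE nsqM; congr ((_)%:C)%C.
have xj1 : nsq (x ^+ j) = 1 by rewrite nsq_exp x1 expr1n.
suff -> : nsq ((x ^+ j) ^ n) = 1 by rewrite mulr1.
case: n {ns} => n; first by rewrite -exprnP nsq_exp xj1 expr1n.
by rewrite NegzE -exprnN -exprVn -(nsq_unit_inv xj1) nsq_exp nsqJ xj1 expr1n.
Qed.

Definition trig2 M (f : int -> int -> C) (x y : C) : C :=
  trig (intbox M) (fun n => trig (intbox M) (f n) y) x.

Lemma parseval2 M : exists (K : nat) (x : C),
  [/\ (0 < K)%N, nsq x = 1 & forall f,
    \sum_(j < K) \sum_(k < K) nsq (trig2 M f (x ^+ j) (x ^+ k)) =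
    K%:R ^+ 2 * \sum_(n <- intbox M) \sum_(m <- intbox M) nsq (f n m)].
Proof.
have [x [x1 xK xd]] := exists_root_of_unity (2 * M).
(* Two elements of [intbox M] differ by less than 2M, which this order exceeds. *)
exists (2 ^ (2 * M).+1)%N, x; split; rewrite ?expn_gt0// => f.
set K := (2 ^ _)%N in xK xd *.
have KM : (2 * M < K)%N by rewrite (ltn_trans (ltnSn _))// ltn_expl.
have x0 := nsq_unit_neq0 x1.
have xs : {in intbox M &, forall n m, n != m -> x ^ (n - m) != 1}.
  have pos (n m : int) : n \in intbox M -> m \in intbox M -> m < n -> x ^ (n - m) != 1.
    rewrite !mem_intbox => h1 h2 h3.
    have -> : n - m = `|n - m|%N%:Z by lia.
    by rewrite -exprnP; apply: xd; lia.
  move=> n m hn hm; case: (ltgtP n m) => // h _; last exact: pos.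
  by rewrite -opprB -invr_expz invr_eq1 pos.
have P := parseval (intbox_uniq M) x1 xK xs.
under eq_bigr => j _.
  under eq_bigr => k _.
    have -> : trig2 M f (x ^+ j) (x ^+ k) =
      trig (intbox M) (fun m => trig (intbox M) (fun n => f n m) (x ^+ j)) (x ^+ k).
      rewrite /trig2 /trig; under eq_bigr do rewrite mulr_suml.
      rewrite exchange_big /=; apply: eq_bigr => m _.
      by rewrite mulr_suml; apply: eq_bigr => n _; ring.
    over.
  rewrite P; over.
rewrite -mulr_sumr exchange_big /=.
under eq_bigr do rewrite P.
by rewrite -mulr_sumr mulrA -expr2 exchange_big.
Qed.

End Fourier.

(** * Bloch fibers over the 2 x 2 cell *)

Section Fibers.
Variable R : realType.
Local Notation C := R[i].
Implicit Types (psi : site -> C) (phi p : bool -> bool -> bool -> C) (x y : C).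

Definition parity (n : int) : bool := odd `|n|.

Lemma parityS n : parity (n + 1) = ~~ parity n.
Proof. by rewrite /parity; lia. Qed.

Lemma parityB1 n : parity (n - 1) = ~~ parity n.
Proof. by rewrite /parity; lia. Qed.

(** The gauge puts a phase on every hop of a given direction, not only on those that leave the cell.
    Changing the sign of [x] or [y] then amounts to multiplying [phi] by a sign depending on [c1] or
    [c2]. *)
Definition fiber p x y phi c1 c2 t : C :=
  phi c1 c2 (~~ t) + (if t then x^-1 else x) * phi (~~ c1) c2 (~~ t)
  + (if t then y^-1 else y) * phi c1 (~~ c2) (~~ t) + p c1 c2 t * phi c1 c2 t.

Definition fiber_normsq phi : R :=
  \sum_(c1 : bool) \sum_(c2 : bool) \sum_(t : bool) nsq (phi c1 c2 t).

Definition sublattice psi c1 c2 t (n m : int) : C :=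
  if (parity n == c1) && (parity m == c2) then psi (n, m, t) else 0.

Lemma trig_shift (s : seq int) (f : int -> C) (d : int) x : uniq s -> x != 0 ->
  (forall n, n \notin s -> f n = 0) -> (forall n, n \notin s -> f (n + d) = 0) ->
  trig s (fun n => f (n + d)) x = x ^ (- d) * trig s f x.
Proof.
move=> us x0 h1 h2; rewrite /trig.
have -> : \sum_(n <- s) f n * x ^ n = \sum_(n <- map (+%R d) s) f n * x ^ n.
  apply: sum_support => //; first by rewrite map_inj_uniq//; exact: addrI.
    by move=> n /h1->; rewrite mul0r.
  move=> n; apply: contraNeq; rewrite mulf_eq0 negb_or => /andP[fn _].
  apply/mapP; exists (n - d); last by rewrite addrC subrK.
  by apply: contraNT fn => /h2; rewrite subrK => ->.
rewrite big_map mulr_sumr; apply: eq_bigr => n _.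
by rewrite mulrCA -expfzDr// addKr addrC.
Qed.

Lemma eq_trig2 M (f g : int -> int -> C) x y :
  (forall n m, f n m = g n m) -> trig2 M f x y = trig2 M g x y.
Proof.
by move=> fg; congr (trig2 M _ x y); apply/funext => n; apply/funext.
Qed.

Lemma trig2D M (f g : int -> int -> C) x y :
  trig2 M (fun n m => f n m + g n m) x y = trig2 M f x y + trig2 M g x y.
Proof.
rewrite /trig2 /trig -big_split; apply: eq_bigr => n _ /=.
rewrite -mulrDl -big_split; congr (_ * _); apply: eq_bigr => m _ /=.
by rewrite mulrDl.
Qed.

Lemma trig2Z M (k : C) (f : int -> int -> C) x y :
  trig2 M (fun n m => k * f n m) x y = k * trig2 M f x y.
Proof.
rewrite /trig2 /trig mulr_sumr; apply: eq_bigr => n _.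
rewrite mulrA mulr_sumr; congr (_ * _); apply: eq_bigr => m _.
by rewrite mulrA.
Qed.

Section Transform.
Variables (M : nat) (psi : site -> C) (x y : C).
Hypotheses (x0 : x != 0) (y0 : y != 0) (supp : supp_in (box M) psi).

(** The box exceeds the support by one layer, so that functions displaced by a hop are still summed
    completely. *)
Let hat f c1 c2 t := trig2 M.+1 (sublattice f c1 c2 t) x y.

Let sublattice0 c1 c2 t n m : ~~ ((n \in intbox M) && (m \in intbox M)) ->
  sublattice psi c1 c2 t n m = 0.
Proof.
by move=> h; rewrite /sublattice; case: ifP => // _; apply: supp; rewrite mem_box.
Qed.

Let intbox_near (d n : int) : (`|d|%N <= 1)%N -> n \notin intbox M.+1 ->
  n + d \notin intbox M.
Proof. by rewrite !mem_intbox; lia. Qed.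

Let near0 n : n \notin intbox M.+1 -> n \notin intbox M.
Proof. by rewrite !mem_intbox; lia. Qed.

Lemma hat_hop1 c1 c2 t : hat (psi \o hop1) c1 c2 t =
  (if t then x^-1 else x) * hat psi (~~ c1) c2 (~~ t).
Proof.
pose d : int := if t then 1 else -1.
have -> : (if t then x^-1 else x) = x ^ (- d).
  by rewrite /d; case: (t); rewrite ?opprK.
rewrite /hat /trig2.
pose g n := trig (intbox M.+1) (sublattice psi (~~ c1) c2 (~~ t) n) y.
have g0 n : n \notin intbox M -> g n = 0.
  move=> h; rewrite /g /trig big1// => m _.
  by rewrite sublattice0 ?mul0r// (negPf h).
rewrite -[RHS](@trig_shift _ g d x (intbox_uniq _) x0); last 2 first.
- by move=> n /near0/g0.
- by move=> n h; apply: g0; apply: intbox_near h; rewrite /d; case: (t).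
congr (trig _ _ x); apply/funext => n; rewrite /g; congr (trig _ _ y).
apply/funext => m; rewrite /sublattice /hop1 /d /=.
by case: (t); rewrite ?parityS ?parityB1 /= eqb_negLR negbK.
Qed.

Lemma hat_hop2 c1 c2 t : hat (psi \o hop2) c1 c2 t =
  (if t then y^-1 else y) * hat psi c1 (~~ c2) (~~ t).
Proof.
pose d : int := if t then 1 else -1.
have -> : (if t then y^-1 else y) = y ^ (- d).
  by rewrite /d; case: (t); rewrite ?opprK.
rewrite /hat /trig2 {1 3}/trig mulr_sumr; apply: eq_bigr => n _.
rewrite mulrA; congr (_ * _); rewrite -trig_shift ?intbox_uniq//; last 2 first.
- by move=> m /near0 h; rewrite sublattice0// (negPf h) andbF.
- move=> m h; rewrite sublattice0// (negPf (intbox_near _ h)) ?andbF//.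
  by rewrite /d; case: (t).
congr (trig _ _ y); apply/funext => m; rewrite /sublattice /hop2 /d /=.
by case: (t); rewrite ?parityS ?parityB1 /= eqb_negLR negbK.
Qed.

Lemma hat_schr (qf : bool -> bool -> bool -> R) z c1 c2 t :
  hat (shift_operator (schr hop0 hop1 hop2
    (fun u => qf (parity u.1.1) (parity u.1.2) u.2)) z psi) c1 c2 t =
  fiber (fun c1 c2 t => (qf c1 c2 t)%:C%C - z) x y (hat psi) c1 c2 t.
Proof.
rewrite /fiber -hat_hop1 -hat_hop2 /hat.
have -> : trig2 M.+1 (sublattice psi c1 c2 (~~ t)) x y =
   trig2 M.+1 (sublattice (psi \o hop0) c1 c2 t) x y by [].
rewrite -trig2Z -!trig2D; apply: eq_trig2 => n m.
rewrite /sublattice /shift_operator /schr /=; case: ifP => [|_]; last by ring.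
by move=> /andP[/eqP-> /eqP->]; ring.
Qed.

End Transform.

Lemma sum_sublattice psi N : \sum_(u <- box N) nsq (psi u) =
  \sum_(c1 : bool) \sum_(c2 : bool) \sum_(t : bool)
    \sum_(n <- intbox N) \sum_(m <- intbox N) nsq (sublattice psi c1 c2 t n m).
Proof.
rewrite sum_box !big_bool /= -!big_split /=; apply: eq_bigr => n _.
rewrite -!big_split /=; apply: eq_bigr => m _; rewrite big_bool /sublattice /=.
by case: (parity n); case: (parity m) => /=; rewrite !nsq0 !(addr0, add0r).
Qed.

(** Parseval writes both sides of the lower bound as averages over the sampled phases, and the fiber
    inequality applies term by term. The sampling grows with the support, hence the demand for one
    [e] valid for all unit phases. *)
Lemma resolvent_fiber (qf : bool -> bool -> bool -> R) (z : C) (e : R) : 0 < e ->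
  (forall x y phi, nsq x = 1 -> nsq y = 1 ->
    e * fiber_normsq phi <=
      fiber_normsq (fiber (fun c1 c2 t => (qf c1 c2 t)%:C%C - z) x y phi)) ->
  resolvent_set (schr hop0 hop1 hop2
    (fun u => qf (parity u.1.1) (parity u.1.2) u.2)) z.
Proof.
move=> e0 low; set q := fun u : site => _.
pose Q := \sum_(c1 : bool) \sum_(c2 : bool) \sum_(t : bool) `|qf c1 c2 t|.
have qQ u : `|q u| <= Q.
  case: u => [[n m] t]; rewrite /q /Q !big_bool /=.
  have h b1 b2 b3 : 0 <= `|qf b1 b2 b3| by exact: normr_ge0.
  have := h true true true; have := h true true false; have := h true false true.
  have := h true false false; have := h false true true; have := h false true false.
  have := h false false true; have := h false false false.
  by case: (parity n); case: (parity m); case: t; lra.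
apply: (resolvent_below hop0K hop1K hop2K qQ e0) => s psi us h1 h2.
have [M sM] := in_some_box s.
have supp : supp_in (box M) psi by exact: supp_in_sub sM h1.
have toN f : supp_in s f -> \sum_(u <- s) nsq (f u) = \sum_(u <- box M.+1) nsq (f u).
  move=> hf; apply: sum_support => //; first exact: box_uniq.
    by move=> u /hf->; rewrite nsq0.
  move=> u h; rewrite hf ?nsq0//; apply: contra h => /sM.
  by apply: sub_box.
rewrite !toN// !sum_sublattice.
have [K [x [K0 x1 P]]] := @parseval2 R M.+1.
have K2 : 0 < K%:R ^+ 2 :> R by rewrite exprn_gt0// ltr0n.
rewrite -(ler_pM2l K2) mulrCA !mulr_sumr.
under eq_bigr => c1 _.
  rewrite mulr_sumr; under eq_bigr => c2 _.
    rewrite mulr_sumr; under eq_bigr => t _ do rewrite -P.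
    over.
  over.
under [leRHS]eq_bigr => c1 _.
  rewrite mulr_sumr; under eq_bigr => c2 _.
    rewrite mulr_sumr; under eq_bigr => t _ do rewrite -P.
    over.
  over.
have swap (F : bool -> bool -> bool -> 'I_K -> 'I_K -> R) :
  \sum_(c1 : bool) \sum_(c2 : bool) \sum_(t : bool) \sum_(j < K) \sum_(k < K)
     F c1 c2 t j k
  = \sum_(j < K) \sum_(k < K) \sum_(c1 : bool) \sum_(c2 : bool) \sum_(t : bool)
     F c1 c2 t j k.
  rewrite !big_bool /= -!big_split /=; apply: eq_bigr => j _.
  rewrite -!big_split /=; apply: eq_bigr => k _.
  by rewrite !big_bool.
rewrite -mulr_sumr !swap mulr_sumr; apply: ler_sum => j _.
rewrite mulr_sumr; apply: ler_sum => k _.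
have xj (i : nat) : nsq (x ^+ i) = 1 by rewrite nsq_exp x1 expr1n.
have := low (x ^+ j) (x ^+ k)
  (fun c1 c2 t => trig2 M.+1 (sublattice psi c1 c2 t) (x ^+ j) (x ^+ k)) (xj j) (xj k).
rewrite /fiber_normsq => /le_trans; apply.
rewrite le_eqVlt; apply/orP; left; apply/eqP.
apply: eq_bigr => c1 _; apply: eq_bigr => c2 _; apply: eq_bigr => t _.
by rewrite -hat_schr// nsq_unit_neq0.
Qed.

End Fibers.

Section Bloch.
Variable R : realType.
Local Notation C := R[i].

Lemma hex_spectrum_fiber (qf : bool -> bool -> bool -> R) (z : C) :
  (forall e : R, 0 < e -> exists (w x y : C) (phi : bool -> bool -> bool -> C),
     [/\ nsq (w - z) <= e, nsq x = 1, nsq y = 1,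
         (exists c1 c2 t, phi c1 c2 t != 0) &
         forall c1 c2 t, fiber (fun c1 c2 t => (qf c1 c2 t)%:C%C - w) x y phi c1 c2 t = 0]) ->
  spectrum (schr hop0 hop1 hop2
    (fun u => qf (parity u.1.1) (parity u.1.2) u.2)) z.
Proof.
move=> h; refine (hex_spectrum_bloch _) => e e0.
have [w [x [y [phi [wz x1 y1 [c1 [c2 [t phi0]]] hphi]]]]] := h e e0.
have x0 := nsq_unit_neq0 x1; have y0 := nsq_unit_neq0 y1.
have nz (v : C) (n : int) : nsq v = 1 -> nsq (v ^ n) = 1.
  move=> v1; case: n => n; first by rewrite -exprnP nsq_exp v1 expr1n.
  by rewrite NegzE -exprnN -exprVn -(nsq_unit_inv v1) nsq_exp nsqJ v1 expr1n.
(* The exponents are negative because a hop that raises [n] by 1 carries the factor [x^-1] in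
   [fiber]. *)
pose Psi (u : site) : C :=
  phi (parity u.1.1) (parity u.1.2) u.2 * (x ^ (- u.1.1) * y ^ (- u.1.2)).
exists w, Psi; split=> //.
- exists (\sum_(c1 : bool) \sum_(c2 : bool) \sum_(t : bool) nsq (phi c1 c2 t)) => u.
  rewrite /Psi nsqM nsqM !nz// !mulr1 !big_bool /=.
  have g b1 b2 b3 : 0 <= nsq (phi b1 b2 b3) by exact: nsq_ge0.
  have := g true true true; have := g true true false; have := g true false true.
  have := g true false false; have := g false true true; have := g false true false.
  have := g false false true; have := g false false false.
  by case: (parity u.1.1); case: (parity u.1.2); case: u.2; lra.
- exists ((c1 : nat)%:Z, (c2 : nat)%:Z, t); rewrite /Psi /= mulf_neq0//; last first.
    by rewrite mulf_neq0// expfz_neq0.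
  by case: (c1) (c2) phi0 => -[].
case=> [[n m] s]; have := hphi (parity n) (parity m) s.
rewrite /fiber /schr /Psi /hop0 /hop1 /hop2 /= => H.
have E1 : x ^ (- (if s then n + 1 else n - 1)) = (if s then x^-1 else x) * x ^ (- n).
  by case: s {H}; rewrite opprD ?opprK expfzDr// mulrC.
have E2 : y ^ (- (if s then m + 1 else m - 1)) = (if s then y^-1 else y) * y ^ (- m).
  by case: s {H E1}; rewrite opprD ?opprK expfzDr// mulrC.
rewrite E1 E2.
have -> : parity (if s then n + 1 else n - 1) = ~~ parity n.
  by case: (s); rewrite ?parityS ?parityB1.
have -> : parity (if s then m + 1 else m - 1) = ~~ parity m.
  by case: (s); rewrite ?parityS ?parityB1.
apply/eqP; rewrite -subr_eq0; apply/eqP.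
rewrite -[RHS](mul0r (x ^ (- n) * y ^ (- m))) -H.
move: (x ^ (- n)) (y ^ (- m)) (if s then x^-1 else x) (if s then y^-1 else y).
by move: ((qf _ _ _)%:C)%C => k X Y a b; ring.
Qed.

End Bloch.

(** * The (2, 2)-periodic potential *)

Lemma det_mx4 (K : comNzRingType) (m : nat -> nat -> K) :
  \det (\matrix_(i < 4, j < 4) m i j) =
    let d2 r1 r2 c1 c2 := m r1 c1 * m r2 c2 - m r1 c2 * m r2 c1 in
    d2 0 1 0 1 * d2 2 3 2 3 - d2 0 1 0 2 * d2 2 3 1 3 + d2 0 1 0 3 * d2 2 3 1 2
    + d2 0 1 1 2 * d2 2 3 0 3 - d2 0 1 1 3 * d2 2 3 0 2 + d2 0 1 2 3 * d2 2 3 0 1.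
Proof.
rewrite (expand_det_row _ ord0) !big_ord_recl big_ord0 /cofactor.
rewrite !(expand_det_row _ ord0) !big_ord_recl !big_ord0 /cofactor.
rewrite !(expand_det_row _ ord0) !big_ord_recl !big_ord0 /cofactor.
rewrite !det_mx11 !mxE /=.
rewrite /bump /=; ring.
Qed.

Section Elimination.
Variables (K : comNzRingType) (l E x xi y yi : K).
Hypotheses (hx : x * xi = 1) (hy : y * yi = 1).

Let g := E ^+ 2 - l ^+ 2.
Let X := x + xi.
Let Y := y + yi.
Let Z := x * yi + y * xi.

(* Splitting a fiber of the Hamiltonian as [[V - E, D], [D^*, - (V + E)]], this is
   the Schur complement (E^2 - l^2) (V - E) + D (E - V) D^*, which involves no
   denominators because V^2 = l^2; x and y are the Bloch phases and xi, yi their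
   inverses. Rows and columns are indexed by the classes (0,0), (1,0), (0,1), (1,1). *)
Definition schur_entry (i j : nat) : K :=
  match i, j with
  | 0%N, 0%N => (E + l) * (3 - g) + 2 * l * g
  | 1%N, 1%N | 2%N, 2%N | 3%N, 3%N => (E + l) * (3 - g) - 2 * l
  | 0%N, 1%N | 1%N, 0%N => (E + l) * X
  | 0%N, 2%N | 2%N, 0%N => (E + l) * Y
  | 0%N, 3%N | 3%N, 0%N => (E + l) * Z
  | 1%N, 2%N => (E + l) * Z - 2 * l * (x * yi)
  | 2%N, 1%N => (E + l) * Z - 2 * l * (y * xi)
  | 1%N, 3%N => (E + l) * Y - 2 * l * yi
  | 3%N, 1%N => (E + l) * Y - 2 * l * y
  | 2%N, 3%N => (E + l) * X - 2 * l * xi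
  | 3%N, 2%N => (E + l) * X - 2 * l * x
  | _, _ => 0
  end.

Definition schur_mx : 'M[K]_4 := \matrix_(i < 4, j < 4) schur_entry i j.

(** The factor (E + l)^3 (E - l) is [g ^+ 4] divided by the determinant (E - l)^3 (E + l) of the
    eliminated block: it comes from clearing denominators. The other factor is the characteristic
    polynomial of the 8 x 8 fiber. *)
Lemma det_schur (w : K) : w = E ^+ 2 - 1 - l ^+ 2 ->
  \det schur_mx = (E + l) ^+ 3 * (E - l) *
    (w ^+ 4 - 8 * w ^+ 3 - 12 * l ^+ 2 * w ^+ 2
     + 2 * (12 - X ^+ 2 - Y ^+ 2 - Z ^+ 2) * w * (w + 2 * l ^+ 2)
     - (4 - X ^+ 2) * (4 - Y ^+ 2) * (4 - Z ^+ 2)).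
Proof.
move=> ->; rewrite det_mx4 /= /X /Y /Z /g.
by ring: hx hy.
Qed.

End Elimination.

(** * Bounds that are uniform in the phases *)

Section Dominated.
Variables (R : realType) (T : Type) (P : T -> Prop).
Implicit Types (D : T -> R) (f g : T -> R[i]).

(** [T] will consist of triples (x, y, phi) and [D] of the squared norm of the fiber applied to phi,
    so dominating each value of phi by [D] is a lower bound with one constant for all phases. Taking
    [D] equal to 1 expresses boundedness. *)
Definition dominated D f :=
  exists2 b : R, 0 <= b & forall t, P t -> nsq (f t) <= b * D t.

Lemma dominated_eq D f g : (forall t, P t -> f t = g t) ->
  dominated D f -> dominated D g.
Proof. by move=> fg [b b0 h]; exists b => // t Pt; rewrite -fg// h. Qed.

Lemma dominatedD D f g : dominated D f -> dominated D g ->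
  dominated D (fun t => f t + g t).
Proof.
move=> [b b0 hf] [c c0 hg]; exists (2 * (b + c)) => [|t Pt].
  by rewrite mulr_ge0// addr_ge0.
by have := nsqD (f t) (g t); have := hf t Pt; have := hg t Pt; lra.
Qed.

Lemma dominatedN D f : dominated D f -> dominated D (fun t => - f t).
Proof. by move=> [b b0 h]; exists b => // t Pt; rewrite nsqN h. Qed.

Lemma dominatedM D f g : dominated (fun=> 1) f -> dominated D g ->
  dominated D (fun t => f t * g t).
Proof.
move=> [b b0 hf] [c c0 hg]; exists (b * c) => [|t Pt]; first exact: mulr_ge0.
have := hf t Pt; rewrite mulr1 => h1.
by rewrite nsqM -mulrA; apply: ler_pM; rewrite ?nsq_ge0// hg.
Qed.

Lemma bounded_cst (k : R[i]) : dominated (fun=> 1) (fun=> k).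
Proof. by exists (nsq k) => [|t _]; rewrite ?nsq_ge0// mulr1. Qed.

Lemma dominated_sum D (J : Type) (r : seq J) (F : J -> T -> R[i]) :
  (forall t, 0 <= D t) ->
  (forall j, dominated D (F j)) -> dominated D (fun t => \sum_(j <- r) F j t).
Proof.
move=> D0 h; elim: r => [|j r IH].
  by exists 0 => // t _; rewrite big_nil nsq0 mul0r.
by apply: dominated_eq (dominatedD (h j) IH) => t _; rewrite big_cons.
Qed.

Lemma bounded_prod (J : Type) (r : seq J) (F : J -> T -> R[i]) :
  (forall j, dominated (fun=> 1) (F j)) ->
  dominated (fun=> 1) (fun t => \prod_(j <- r) F j t).
Proof.
move=> h; elim: r => [|j r IH].
  by apply: dominated_eq (bounded_cst 1) => t _; rewrite big_nil.
by apply: dominated_eq (dominatedM (h j) IH) => t _; rewrite big_cons.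
Qed.

Lemma bounded_det n (M : T -> 'M[R[i]]_n) :
  (forall i j, dominated (fun=> 1) (fun t => M t i j)) ->
  dominated (fun=> 1) (fun t => \det (M t)).
Proof.
move=> h; rewrite /determinant; apply: dominated_sum => // s.
by apply: dominatedM; [exact: bounded_cst|apply: bounded_prod].
Qed.

Lemma bounded_adj n (M : T -> 'M[R[i]]_n) :
  (forall i j, dominated (fun=> 1) (fun t => M t i j)) ->
  forall i j, dominated (fun=> 1) (fun t => \adj (M t) i j).
Proof.
move=> h i j; apply: dominated_eq (_ : dominated _ (fun t => cofactor (M t) j i)).
  by move=> t _; rewrite mxE.
rewrite /cofactor; apply: dominatedM; first exact: bounded_cst.
apply: bounded_det => k l; apply: dominated_eq (h (lift j k) (lift i l)) => t _.
by rewrite !mxE.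
Qed.

End Dominated.

(** In a product the left factor has to be the bounded one, which is why the formulas submitted to
    this descent carry their coefficients on the left. *)
Ltac dominated_rec base := lazymatch goal with
  | |- dominated _ _ (fun _ => ?k) => exact: bounded_cst
  | |- dominated _ _ (fun t => (@?f t + @?g t)%R) =>
      apply: (dominatedD (f := f) (g := g)); dominated_rec base
  | |- dominated _ _ (fun t => (- @?f t)%R) =>
      apply: (dominatedN (f := f)); dominated_rec base
  | |- dominated _ _ (fun t => (@?f t * @?g t)%R) =>
      apply: (dominatedM (f := f) (g := g)); dominated_rec base
  | _ => base tt
  end.

Section TwoByTwoPotential.
Variable R : realType.
Local Notation C := R[i].

Lemma fiber_normsq_ge (phi : bool -> bool -> bool -> C) c1 c2 t :
  nsq (phi c1 c2 t) <= fiber_normsq phi.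
Proof.
rewrite /fiber_normsq !big_bool /=.
have h b1 b2 b3 : 0 <= nsq (phi b1 b2 b3) by exact: nsq_ge0.
have := h true true true; have := h true true false; have := h true false true.
have := h true false false; have := h false true true; have := h false true false.
have := h false false true; have := h false false false.
by case: c1 c2 t => [] [] []; lra.
Qed.

Lemma dominated_fiber_below (p : bool -> bool -> bool -> C) :
  (forall c1 c2 t', dominated (fun t : C * C * (bool -> bool -> bool -> C) =>
       nsq t.1.1 = 1 /\ nsq t.1.2 = 1)
     (fun t => fiber_normsq (fiber p t.1.1 t.1.2 t.2)) (fun t => t.2 c1 c2 t')) ->
  exists2 k : R, 0 < k & forall x y phi, nsq x = 1 -> nsq y = 1 ->
    k * fiber_normsq phi <= fiber_normsq (fiber p x y phi).
Proof.
set P := fun t => _; set D := fun t => _; move=> dAll.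
have D0 t : 0 <= D t by exact: le_trans (nsq_ge0 _) (fiber_normsq_ge _ true true true).
have [b b0 hb] : exists2 b : R, 0 <= b &
    forall t, P t -> fiber_normsq t.2 <= b * D t.
  have [b1 p1 h1] := dAll true true true; have [b2 p2 h2] := dAll true true false.
  have [b3 p3 h3] := dAll true false true; have [b4 p4 h4] := dAll true false false.
  have [b5 p5 h5] := dAll false true true; have [b6 p6 h6] := dAll false true false.
  have [b7 p7 h7] := dAll false false true; have [b8 p8 h8] := dAll false false false.
  exists (b1 + b2 + b3 + b4 + b5 + b6 + b7 + b8); first by rewrite !addr_ge0.
  move=> t Pt; have := h1 t Pt; have := h2 t Pt; have := h3 t Pt; have := h4 t Pt.
  have := h5 t Pt; have := h6 t Pt; have := h7 t Pt; have := h8 t Pt.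
  by rewrite /fiber_normsq !big_bool /=; lra.
exists (b + 1)^-1; first by rewrite invr_gt0 ltr_wpDl.
move=> x y phi x1 y1; rewrite ler_pdivrMl ?ltr_wpDl//.
have := hb (x, y, phi) (conj x1 y1); have := D0 (x, y, phi); rewrite /D /=; lra.
Qed.

(* The eight classes modulo (2, 2) form a cube graph, labelled by signs so that
   neighbors differ in one sign; [pot2] is the majority sign. *)
Definition pot2 (c1 c2 t : bool) : R :=
  if t then (if c1 && c2 then -1 else 1) else (if c1 || c2 then -1 else 1).

Definition class_comp (phi : bool -> bool -> bool -> C) (t : bool) (k : nat) : C :=
  match k with
  | 0%N => phi false false t
  | 1%N => phi true false t
  | 2%N => phi false true t
  | _ => phi true true t
  end.

Variables (lam E : R).
Let l : C := (lam%:C)%C.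
Let e : C := (E%:C)%C.
Let g : C := e ^+ 2 - l ^+ 2.
Let p (c1 c2 t : bool) : C := ((lam * pot2 c1 c2 t)%:C)%C - e.

Let pE c1 c2 t : p c1 c2 t =
  (if t then (if c1 && c2 then - l else l) else (if c1 || c2 then - l else l)) - e.
Proof.
by rewrite /p /pot2 /l; case: c1 c2 t => [] [] []; rewrite /= ?mulr1 ?mulrN1 ?rmorphN.
Qed.

(** Elimination of the second sublattice with the residuals [f] and [h] kept: with residuals as data
    it gives the lower bound, and with zero residuals it gives the kernel. *)
Lemma schur_row (x y : C) (phi : bool -> bool -> bool -> C) (j : 'I_4) :
  x != 0 -> y != 0 ->
  let f := class_comp (fiber p x y phi) false in
  let h := class_comp (fiber p x y phi) true in
  ((\row_(i < 4) class_comp phi false i) *m schur_mx l e x x^-1 y y^-1) 0 j =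
  g * f j + (match val j with
   | 0%N => (l + e) * h 0%N + x * ((l + e) * h 1%N) + y * ((l + e) * h 2%N)
   | 1%N => (l + e) * h 1%N + x * ((l + e) * h 0%N) + y * ((e - l) * h 3%N)
   | 2%N => (l + e) * h 2%N + x * ((e - l) * h 3%N) + y * ((l + e) * h 0%N)
   | _ => (e - l) * h 3%N + x * ((l + e) * h 2%N) + y * ((l + e) * h 1%N)
   end).
Proof.
move=> x0 y0 /=; rewrite !mxE !big_ord_recl big_ord0 !mxE /bump /=.
rewrite /fiber; case: j => [[|[|[|[|j]]]] //=] _; rewrite !pE /= /g;
  by field; rewrite x0 y0.
Qed.

Let T : Type := (C * C * (bool -> bool -> bool -> C))%type.
Let P (t : T) : Prop := nsq t.1.1 = 1 /\ nsq t.1.2 = 1.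
Let D (t : T) : R := fiber_normsq (fiber p t.1.1 t.1.2 t.2).

Lemma fiber_below (c0 : R) : E ^+ 2 != lam ^+ 2 -> 0 < c0 ->
  (forall x y : C, nsq x = 1 -> nsq y = 1 ->
     c0 <= nsq (\det (schur_mx l e x x^-1 y y^-1))) ->
  exists2 k : R, 0 < k & forall x y phi, nsq x = 1 -> nsq y = 1 ->
    k * fiber_normsq phi <= fiber_normsq (fiber p x y phi).
Proof.
move=> Elam c00 hdet.
have g0 : g != 0.
  by rewrite /g /e /l -!rmorphXn -rmorphB /= -nsq_eq0 nsq_real sqrf_eq0 subr_eq0.
have D0 t : 0 <= D t by exact: le_trans (nsq_ge0 _) (fiber_normsq_ge _ true true true).
have bx : dominated P (fun=> 1) (fun t => t.1.1).
  by exists 1 => // t [-> _]; rewrite mulr1.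
have by_ : dominated P (fun=> 1) (fun t => t.1.2).
  by exists 1 => // t [_ ->]; rewrite mulr1.
have bxi : dominated P (fun=> 1) (fun t => t.1.1^-1).
  by exists 1 => // t [x1 _]; rewrite mulr1 -nsq_unit_inv// nsqJ x1.
have byi : dominated P (fun=> 1) (fun t => t.1.2^-1).
  by exists 1 => // t [_ y1]; rewrite mulr1 -nsq_unit_inv// nsqJ y1.
pose N (t : T) := schur_mx l e t.1.1 t.1.1^-1 t.1.2 t.1.2^-1.
have bN i j : dominated P (fun=> 1) (fun t => N t i j).
  apply: (dominated_eq (f := fun t => schur_entry l e t.1.1 t.1.1^-1 t.1.2 t.1.2^-1 i j)).
    by move=> t _; rewrite mxE.
  case: i j => [[|[|[|[|i]]]] //= _] [[|[|[|[|j]]]] //= _];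
    dominated_rec ltac:(fun _ => first [exact: bx|exact: by_|exact: bxi|exact: byi]).
have dh c1 c2 t' : dominated P D (fun t => fiber p t.1.1 t.1.2 t.2 c1 c2 t').
  by exists 1 => // t _; rewrite mul1r; exact: fiber_normsq_ge.
have dr (j : 'I_4) : dominated P D
  (fun t => ((\row_(i < 4) class_comp t.2 false i) *m N t) 0 j).
  apply: dominated_eq => [t [x1 y1]|].
    by symmetry; apply: schur_row; exact: nsq_unit_neq0.
  case: j => [[|[|[|[|j]]]] //= _];
    dominated_rec ltac:(fun _ => first [exact: bx|exact: by_|exact: bxi|exact: byi|exact: dh]).
have bdet : dominated P (fun=> 1) (fun t => (\det (N t))^-1).
  exists c0^-1 => [|t [x1 y1]]; first by rewrite invr_ge0 ltW.
  have h := hdet _ _ x1 y1; have d0 : 0 < nsq (\det (N t)) by exact: lt_le_trans h.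
  have d1 : \det (N t) != 0 by rewrite -nsq_eq0 gt_eqF.
  have -> : nsq ((\det (N t))^-1) = (nsq (\det (N t)))^-1.
    apply: (mulfI (lt0r_neq0 d0)); rewrite -nsqM divff// divff ?lt0r_neq0//.
    by rewrite /nsq /= expr0n addr0 expr1n.
  by rewrite mulr1 lef_pV2 // posrE.
have du (i : 'I_4) : dominated P D (fun t => class_comp t.2 false i).
  apply: dominated_eq => [t [x1 y1]|].
    have h := hdet _ _ x1 y1; have d0 : 0 < nsq (\det (N t)) by exact: lt_le_trans h.
    have d1 : \det (N t) != 0 by rewrite -nsq_eq0 gt_eqF.
    (* Cramer's rule: adjugate and inverse determinant are bounded, so the first sublattice is
       controlled by the residuals. *)
    transitivity ((\det (N t))^-1 *
        (((\row_(i < 4) class_comp t.2 false i) *m N t) *m \adj (N t)) 0 i).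
      reflexivity.
    rewrite -mulmxA mul_mx_adj mul_mx_scalar !mxE mulrA mulVf// mul1r //.
  apply: dominatedM bdet _; under [X in dominated _ _ X]funext do rewrite mxE.
  apply: dominated_sum => // j.
  apply: dominated_eq => [t _|]; first by rewrite mulrC; reflexivity.
  by apply: dominatedM (dr j); exact: bounded_adj.
have dA c1 c2 : dominated P D (fun t => t.2 c1 c2 false).
  have d0 := du (@Ordinal 4 0 isT); have d1 := du (@Ordinal 4 1 isT).
  have d2 := du (@Ordinal 4 2 isT); have d3 := du (@Ordinal 4 3 isT).
  by case: c1 c2 => [] [].
have dB c1 c2 : dominated P D (fun t => t.2 c1 c2 true).
  (* [g^-1 * s] is the inverse of E minus the potential at this site, which recovers the second
     sublattice from the first. *)
  pose s : C := if c1 && c2 then e - l else l + e.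
  apply: (dominated_eq (f := fun t => g^-1 * (s * (t.2 c1 c2 false
    + t.1.1^-1 * t.2 (~~ c1) c2 false + t.1.2^-1 * t.2 c1 (~~ c2) false
    - fiber p t.1.1 t.1.2 t.2 c1 c2 true)))).
    move=> t _; apply: (mulfI g0); rewrite mulrA divff// mul1r /fiber /= pE /s /g.
    by case: (c1 && c2); ring.
  dominated_rec ltac:(fun _ => first [exact: bx|exact: by_
    |exact: bxi|exact: byi|exact: dh|exact: dA]).
have dAll c1 c2 t' : dominated P D (fun t => t.2 c1 c2 t').
  by case: t'.
exact: (dominated_fiber_below dAll).
Qed.

Lemma pot2_resolvent (c0 : R) : E ^+ 2 != lam ^+ 2 -> 0 < c0 ->
  (forall x y : C, nsq x = 1 -> nsq y = 1 ->
     c0 <= nsq (\det (schur_mx l e x x^-1 y y^-1))) ->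
  resolvent_set (schr hop0 hop1 hop2
    (fun u => lam * pot2 (parity u.1.1) (parity u.1.2) u.2)) e.
Proof.
move=> h1 h2 h3; have [k k0 hk] := fiber_below h1 h2 h3.
exact: (@resolvent_fiber _ (fun c1 c2 t => lam * pot2 c1 c2 t) _ k k0 hk).
Qed.

Lemma pot2_kernel (x y : C) : E ^+ 2 != lam ^+ 2 -> nsq x = 1 -> nsq y = 1 ->
  \det (schur_mx l e x x^-1 y y^-1) = 0 ->
  exists2 phi, (exists c1 c2 t, phi c1 c2 t != 0) &
    forall c1 c2 t, fiber p x y phi c1 c2 t = 0.
Proof.
move=> Elam x1 y1 /eqP/det0P[u u0 uN].
have x0 := nsq_unit_neq0 x1; have y0 := nsq_unit_neq0 y1.
have g0 : g != 0.
  by rewrite /g /e /l -!rmorphXn -rmorphB /= -nsq_eq0 nsq_real sqrf_eq0 subr_eq0.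
pose k (c1 c2 : bool) : 'I_4 := if c2 then (if c1 then @Ordinal 4 3 isT else @Ordinal 4 2 isT)
  else (if c1 then @Ordinal 4 1 isT else @Ordinal 4 0 isT).
(* Scaling the kernel vector by [g] removes the denominators from the second sublattice. *)
pose a c1 c2 := g * u 0 (k c1 c2).
pose phi c1 c2 (t : bool) : C := if t then
  (if c1 && c2 then e - l else l + e) *
    (u 0 (k c1 c2) + x^-1 * u 0 (k (~~ c1) c2) + y^-1 * u 0 (k c1 (~~ c2)))
  else a c1 c2.
have uE : u = g^-1 *: (\row_(i < 4) class_comp phi false i).
  apply/rowP => i; rewrite !mxE; apply: (mulfI g0); rewrite mulrA divff// mul1r.
  case: i => [[|[|[|[|i]]]] //= lt]; rewrite /phi /a /k /=; congr (_ * u 0 _); exact: val_inj.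
have hB c1 c2 : fiber p x y phi c1 c2 true = 0.
  by rewrite /fiber /= pE /phi /a /g; case: (c1 && c2) => /=; ring.
have hA (j : 'I_4) : class_comp (fiber p x y phi) false j = 0.
  apply: (mulfI g0); rewrite mulr0.
  have := schur_row phi j x0 y0; rewrite /= => E0.
  have rN : (\row_(i < 4) class_comp phi false i) *m schur_mx l e x x^-1 y y^-1 = 0.
    apply: (scalerI (invr_neq0 g0)); by rewrite scalemxAl -uE uN scaler0.
  move: E0; rewrite rN mxE hB !mulr0 !addr0.
  case: j => [[|[|[|[|j]]]] //= lt]; rewrite !hB !mulr0 !addr0 => ->//.
exists phi.
  have /rV0Pn[i ui] : \row_(i < 4) class_comp phi false i != 0.
    by apply: contra u0 => /eqP h; rewrite uE h scaler0.
  move: ui; rewrite mxE.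
  case: i => [[|[|[|[|i]]]] //= lt] h.
  - by exists false, false, false.
  - by exists true, false, false.
  - by exists false, true, false.
  - by exists true, true, false.
move=> c1 c2 [|]; first exact: hB.
have d0 := hA (@Ordinal 4 0 isT); have d1 := hA (@Ordinal 4 1 isT).
have d2 := hA (@Ordinal 4 2 isT); have d3 := hA (@Ordinal 4 3 isT).
by case: c1 c2 => [] [].
Qed.
End TwoByTwoPotential.

(** * Sign of the fiber determinant on the torus *)

Section Secular.
Variable R : realType.
Implicit Types (l E w a b c s t : R).

Definition secular l w a b c : R :=
  w ^+ 4 - 8 * w ^+ 3 - 12 * l ^+ 2 * w ^+ 2
  + 8 * (3 - a ^+ 2 - b ^+ 2 - c ^+ 2) * (w * (w + 2 * l ^+ 2))
  - 64 * ((1 - a ^+ 2) * (1 - b ^+ 2) * (1 - c ^+ 2)).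

(** At x = y = 1 the determinant is w^2 [edge0], and at the Dirac point it is (w - 3) [edgeK]. *)
Definition edge0 l w : R := w ^+ 2 - 8 * w - 12 * l ^+ 2.
Definition edgeK l w : R := (w + 1) * (w - 3) ^+ 2 - 12 * l ^+ 2 * w.

(* With a, b, c the cosines of the angles of x, y, x / y, the 8 x 8 determinant of
   H - E is [secular l w a b c] at w = E^2 - 1 - l^2; it has to be evaluated on
   1 + 2abc = a^2 + b^2 + c^2. *)
Lemma det_schur_secular l E (x y : R[i]) : nsq x = 1 -> nsq y = 1 ->
  \det (schur_mx (l%:C)%C (E%:C)%C x x^-1 y y^-1) =
  (((E + l) ^+ 3 * (E - l) * secular l (E ^+ 2 - 1 - l ^+ 2)
    (complex.Re x) (complex.Re y)
    (complex.Re x * complex.Re y + complex.Im x * complex.Im y))%:C)%C.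
Proof.
move=> x1 y1; have x0 := nsq_unit_neq0 x1; have y0 := nsq_unit_neq0 y1.
rewrite (det_schur (mulfV x0) (mulfV y0) erefl) -!nsq_unit_inv//.
set w := E ^+ 2 - 1 - l ^+ 2.
have -> : x + (x^*)%C = ((2 * complex.Re x)%:C)%C.
  by case: (x) => a s; apply/eqP; rewrite eq_complex /=; apply/andP; split; apply/eqP; ring.
have -> : y + (y^*)%C = ((2 * complex.Re y)%:C)%C.
  by case: (y) => a s; apply/eqP; rewrite eq_complex /=; apply/andP; split; apply/eqP; ring.
have -> : x * (y^*)%C + y * (x^*)%C =
    ((2 * (complex.Re x * complex.Re y + complex.Im x * complex.Im y))%:C)%C.
  case: (x) (y) => a s [b t]; apply/eqP; rewrite eq_complex /=.
  by apply/andP; split; apply/eqP; ring.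
set a := complex.Re x; set b := complex.Re y; set c := a * b + _.
have -> : (E%:C)%C ^+ 2 - 1 - (l%:C)%C ^+ 2 = (w%:C)%C :> R[i].
  by rewrite /w !rmorphB !rmorphXn rmorph1.
have cN (n : nat) : (n%:R : R[i]) = ((n%:R : R)%:C)%C by rewrite rmorph_nat.
rewrite !(cN 2%N, cN 8%N, cN 12%N, cN 4%N).
rewrite -!(rmorphXn, rmorphM, rmorphD, rmorphB) /=; congr ((_)%:C)%C.
by rewrite /secular; ring.
Qed.

Section Torus.
Variables (a s b t : R).
Hypotheses (hs : s ^+ 2 = 1 - a ^+ 2) (ht : t ^+ 2 = 1 - b ^+ 2).
Let c := a * b + s * t.

Lemma torus_sin : 1 - c ^+ 2 = (s * b - a * t) ^+ 2.
Proof. by rewrite /c; ring: hs ht. Qed.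

(** The difference is |1 + x^2 + y^2|^2 / 4 for x = a + i s and y = b + i t. *)
Lemma torus_sum_le : (1 - a ^+ 2) + (1 - b ^+ 2) + (1 - c ^+ 2) <= 9 / 4.
Proof.
rewrite -subr_ge0.
have -> : 9 / 4 - ((1 - a ^+ 2) + (1 - b ^+ 2) + (1 - c ^+ 2)) =
  ((2 * a ^+ 2 + 2 * b ^+ 2 - 1) ^+ 2 + (2 * a * s + 2 * b * t) ^+ 2) / 4.
  by rewrite /c; field: hs ht.
by rewrite divr_ge0// addr_ge0 ?sqr_ge0.
Qed.

(* This is the product of |1 + x + y|^2 over the four sign
   changes of x = a + i s and y = b + i t. *)
Lemma torus_product_ge0 :
  0 <= 9 + 8 * ((1 - a ^+ 2) + (1 - b ^+ 2) + (1 - c ^+ 2))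
       - 64 * ((1 - a ^+ 2) * (1 - b ^+ 2) * (1 - c ^+ 2)).
Proof.
have -> : 9 + 8 * ((1 - a ^+ 2) + (1 - b ^+ 2) + (1 - c ^+ 2))
       - 64 * ((1 - a ^+ 2) * (1 - b ^+ 2) * (1 - c ^+ 2)) =
   ((1 + a + b) ^+ 2 + (s + t) ^+ 2) * ((1 + a - b) ^+ 2 + (s - t) ^+ 2) *
   (((1 - a + b) ^+ 2 + (s - t) ^+ 2) * ((1 - a - b) ^+ 2 + (s + t) ^+ 2)).
  by rewrite /c; ring: hs ht.
by rewrite !mulr_ge0// addr_ge0 ?sqr_ge0.
Qed.

Let A := 1 - a ^+ 2.
Let B := 1 - b ^+ 2.
Let C := 1 - c ^+ 2.

Lemma torus_bounds : [/\ 0 <= A, 0 <= B, 0 <= C, B <= 1 & C <= 1].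
Proof.
split; rewrite /A /B /C; first by rewrite -hs sqr_ge0.
- by rewrite -ht sqr_ge0.
- by rewrite torus_sin sqr_ge0.
- by rewrite gerBl sqr_ge0.
- by rewrite gerBl sqr_ge0.
Qed.

(** The hypotheses force w >= 8, hence w (w + 2 l^2) >= 64, and the term in the sum of the squared
    sines outweighs 64 times their product. The minimum is thus at x = y = 1. *)
Lemma secular_top l w : 0 <= w -> 0 < edge0 l w ->
  w ^+ 2 * edge0 l w <= secular l w a b c.
Proof.
move=> w0 h; have [A0 B0 C0 B1 C1] := torus_bounds.
have l0 : 0 <= l ^+ 2 by exact: sqr_ge0.
have w8 : 8 <= w.
  rewrite leNgt; apply/negP => w8; have : w * (8 - w) >= 0 by rewrite mulr_ge0// subr_ge0 ltW.
  by move: h; rewrite /edge0; lra.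
have k0 : 64 <= w * (w + 2 * l ^+ 2).
  apply: le_trans (_ : 8 * 8 <= _); first by lra.
  by apply: ler_pM => //; lra.
have P1 : A * B * C <= A.
  by rewrite -mulrA ler_piMr// mulr_ile1.
have : 64 * (A + B + C) <= w * (w + 2 * l ^+ 2) * (A + B + C).
  by rewrite ler_wpM2r//; apply: addr_ge0 => //; exact: addr_ge0.
rewrite /secular /edge0; move: P1; rewrite /A /B /C in A0 B0 C0 *.
set u := w * (w + _); set P := (1 - a ^+ 2) * _ * _ => P1 P2.
have -> : w ^+ 2 * (w ^+ 2 - 8 * w - 12 * l ^+ 2) =
  w ^+ 4 - 8 * w ^+ 3 - 12 * l ^+ 2 * w ^+ 2 by ring.
lra.
Qed.

(** Here [edge0 l w < 0] forces w + 2 l^2 >= 0, so both terms that depend on the phases are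
    nonpositive and the maximum is at x = y = 1. *)
Lemma secular_middle l w : w < 0 -> edge0 l w < 0 ->
  secular l w a b c <= w ^+ 2 * edge0 l w.
Proof.
move=> w0 h; have [A0 B0 C0 B1 C1] := torus_bounds.
have l0 : 0 <= l ^+ 2 by exact: sqr_ge0.
have w2 : 0 <= w + 2 * l ^+ 2.
  by move: h; rewrite /edge0; have := sqr_ge0 w; lra.
have k0 : w * (w + 2 * l ^+ 2) <= 0 by rewrite nmulr_rle0.
have P0 : 0 <= A * B * C by apply: mulr_ge0 => //; exact: mulr_ge0.
have : w * (w + 2 * l ^+ 2) * (A + B + C) <= 0.
  by rewrite mulr_le0_ge0//; apply: addr_ge0 => //; exact: addr_ge0.
rewrite /secular /edge0; move: P0; rewrite /A /B /C.
set u := w * (w + _); set P := (1 - a ^+ 2) * _ * _ => P1 P2.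
have -> : w ^+ 2 * (w ^+ 2 - 8 * w - 12 * l ^+ 2) =
  w ^+ 4 - 8 * w ^+ 3 - 12 * l ^+ 2 * w ^+ 2 by ring.
lra.
Qed.

(* [edgeK] is the value at the Dirac point; the excess over it is
   the product of [torus_product_ge0] plus 8 (1 - w (w + 2 l^2)) (9/4 - S), where
   S is the sum of the three squared sines. *)
Lemma secular_bottom l w : l ^+ 2 <= 1 -> - (1 + l ^+ 2) <= w -> w < 0 -> edgeK l w < 0 ->
  (w - 3) * edgeK l w <= secular l w a b c.
Proof.
move=> l1 w1 w0 h; have l0 : 0 <= l ^+ 2 by exact: sqr_ge0.
(* This is (w + l^2)^2 - l^4, where |w + l^2| <= 1; the bound -(1 + l^2) <= w expresses E^2 >= 0. *)
have k1 : w * (w + 2 * l ^+ 2) <= 1.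
  have : 0 <= (1 - (w + l ^+ 2)) * (1 + (w + l ^+ 2)) by apply: mulr_ge0; lra.
  have := sqr_ge0 (l ^+ 2); lra.
have := torus_sum_le; have := torus_product_ge0.
have : 0 <= (1 - w * (w + 2 * l ^+ 2)) * (9 / 4 - ((1 - a ^+ 2) + (1 - b ^+ 2) + (1 - c ^+ 2))).
  by rewrite mulr_ge0 ?subr_ge0// torus_sum_le.
rewrite /secular /edgeK; set P := (1 - a ^+ 2) * _ * _.
have -> : (w - 3) * ((w + 1) * (w - 3) ^+ 2 - 12 * l ^+ 2 * w) =
  w ^+ 4 - 8 * w ^+ 3 - 12 * l ^+ 2 * w ^+ 2 + 18 * (w * (w + 2 * l ^+ 2)) - 27 by ring.
set u := w * (w + _); lra.
Qed.

End Torus.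

End Secular.

(** * Band edges and the spectrum for the majority potential *)

Section Band.
Variable R : realType.
Implicit Types (l E w a b c s t : R).

Definition shifted l E : R := E ^+ 2 - 1 - l ^+ 2.

Definition band2 l E : Prop := let w := shifted l E in
  (0 <= w /\ edge0 l w <= 0) \/ [/\ w < 0, 0 <= edgeK l w & 0 <= edge0 l w].

(* Along y = x^-1 with x = sqrt (1 - A) + i sqrt A: the point Gamma is A = 0,
   the Dirac point K is A = 3/4. *)
Definition secular_path l w (A : R) : R :=
  w ^+ 4 - 8 * w ^+ 3 - 12 * l ^+ 2 * w ^+ 2
  + 8 * (6 * A - 4 * A ^+ 2) * (w * (w + 2 * l ^+ 2)) - 256 * (A ^+ 3 * (1 - A)).

Lemma secular_path0 l w : secular_path l w 0 = w ^+ 2 * edge0 l w.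
Proof. by rewrite /secular_path /edge0; ring. Qed.

Lemma secular_pathK l w : secular_path l w (3 / 4) = (w - 3) * edgeK l w.
Proof. by rewrite /secular_path /edgeK; field. Qed.

Lemma secular_path1 l w : secular_path l w 1 =
  w * (w * (w - 4) ^+ 2 + l ^+ 2 * (32 - 12 * w)).
Proof. by rewrite /secular_path; ring. Qed.

Lemma secular_path_ivt l w A1 : 0 <= A1 <= 1 ->
  secular_path l w 0 * secular_path l w A1 <= 0 ->
  exists2 A, 0 <= A <= 1 & secular_path l w A = 0.
Proof.
move=> /andP[A0 A1'] h.
pose p : {poly R} := (w ^+ 4 - 8 * w ^+ 3 - 12 * l ^+ 2 * w ^+ 2)%:P
  + (8 * (w * (w + 2 * l ^+ 2)))%:P * (6%:P * 'X - 4%:P * 'X ^+ 2)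
  - 256%:P * ('X ^+ 3 * (1 - 'X)).
have pE A : p.[A] = secular_path l w A.
  by rewrite /p /secular_path !hornerE /=; ring.
have [x hx /rootP rx] : exists2 x, 0 <= x <= A1 & root p x.
  have [n0|p0] := lerP (secular_path l w 0) 0.
    have [n1|p1] := lerP 0 (secular_path l w A1).
      have := @poly_ivt _ p 0 A1 A0; rewrite !pE n0 n1 => /(_ isT)[x].
      by move=> hx rx; exists x.
    have z0 : secular_path l w 0 = 0.
      by apply/eqP; rewrite eq_le n0 /= -(nmulr_lle0 _ p1).
    by exists 0; rewrite ?lexx// /root pE z0.
  have n1 : secular_path l w A1 <= 0 by rewrite -(pmulr_rle0 _ p0).
  have := @poly_ivt _ (- p) 0 A1 A0; rewrite !hornerN !pE oppr_le0 oppr_ge0 (ltW p0) n1.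
  by move=> /(_ isT)[x hx]; rewrite rootN => rx; exists x.
exists x; last by rewrite -pE.
by case/andP: hx => -> /= hx; exact: le_trans A1'.
Qed.

(** The determinant has opposite signs (or a zero) at A = 0 and at a second point. For w >= 0 no
    single second point works: the value at A = 1 is negative near w = 4, and that at A = 3/4 just
    above w = 3. Hence the switch at w = 7/2. *)
Lemma band2_zero l E : l ^+ 2 <= 1 / 400 -> band2 l E ->
  exists2 A, 0 <= A <= 1 & secular_path l (shifted l E) A = 0.
Proof.
rewrite /band2; set w := shifted l E; clearbody w => le; have l0 := sqr_ge0 l.
have sqw : 0 <= w ^+ 2 by exact: sqr_ge0.
case=> [[w0 h]|[w0 hK h]]; last first.
  apply: (@secular_path_ivt _ _ (3 / 4)); first by lra.
  rewrite secular_path0 secular_pathK; apply: mulr_ge0_le0; first exact: mulr_ge0.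
  by apply: mulr_le0_ge0 => //; lra.
have [w1|w1] := lerP w (7 / 2).
  apply: (@secular_path_ivt _ _ 1); first by lra.
  rewrite secular_path0 secular_path1; apply: mulr_le0_ge0; first exact: mulr_ge0_le0.
  apply: mulr_ge0 => //; have [w2|w2] := lerP w (8 / 3).
    apply: addr_ge0; first by rewrite mulr_ge0// sqr_ge0.
    by apply: mulr_ge0 => //; lra.
  have : 0 <= w * ((w - 4) ^+ 2 - 1 / 4).
    apply: mulr_ge0 => //.
    have : 0 <= (7 / 2 - w) * (9 / 2 - w) by apply: mulr_ge0; lra.
    lra.
  have : 0 <= (1 / 400 - l ^+ 2) * (12 * w - 32) by apply: mulr_ge0; lra.
  lra.
apply: (@secular_path_ivt _ _ (3 / 4)); first by lra.
rewrite secular_path0 secular_pathK; apply: mulr_le0_ge0; first exact: mulr_ge0_le0.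
apply: mulr_ge0; first by lra.
have : 0 <= (w + 1) * ((w - 3) ^+ 2 - 1 / 4).
  apply: mulr_ge0; first by lra.
  have : 0 <= (w - 7 / 2) * (w - 5 / 2) by apply: mulr_ge0; lra.
  lra.
have : 0 <= (1 / 400 - l ^+ 2) * w by apply: mulr_ge0; lra.
rewrite /edgeK; lra.
Qed.

(** E^2 = l^2 means w = -1, where [edge0] and [edgeK] are both nonnegative; the exceptional energies
    thus never lie in a gap. The constant is the absolute value of the determinant at x = y = 1 or
    at the Dirac point. *)
Lemma band2_gap l E : l ^+ 2 <= 1 / 400 -> ~ band2 l E ->
  [/\ E ^+ 2 != l ^+ 2 & exists2 c0 : R, 0 < c0 & forall a s b t : R,
     s ^+ 2 = 1 - a ^+ 2 -> t ^+ 2 = 1 - b ^+ 2 ->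
     c0 <= `|secular l (shifted l E) a b (a * b + s * t)| ].
Proof.
have sE := sqr_ge0 E; have l0 := sqr_ge0 l.
have wE : - (1 + l ^+ 2) <= shifted l E by rewrite /shifted; lra.
have gE : shifted l E != -1 -> E ^+ 2 != l ^+ 2.
  by apply: contra => /eqP h; rewrite /shifted h; apply/eqP; ring.
move: wE gE; rewrite /band2; set w := shifted l E; clearbody w => wE gE le nb.
have [w0|w0] := lerP 0 w.
  have h : 0 < edge0 l w by rewrite ltNge; apply/negP => h; apply: nb; left.
  have wn : w != 0 by apply: contraTneq h => ->; rewrite /edge0 -leNgt; lra.
  split; first by apply: gE; rewrite gt_eqF//; lra.
  exists (w ^+ 2 * edge0 l w) => [|a s b t hs ht].
    by rewrite mulr_gt0// exprn_even_gt0.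
  exact: le_trans (secular_top hs ht w0 h) (ler_norm _).
have [h|h] := ltP (edge0 l w) 0.
  split.
    apply: gE; apply: contraTneq h => ->; rewrite /edge0 -leNgt; lra.
  exists (- (w ^+ 2 * edge0 l w)) => [|a s b t hs ht].
    by rewrite oppr_gt0 pmulr_rlt0// exprn_even_gt0//= lt_eqF.
  rewrite -normrN; apply: le_trans (ler_norm _); rewrite lerN2.
  exact: secular_middle.
have hK : edgeK l w < 0 by rewrite ltNge; apply/negP => hK; apply: nb; right.
split.
  by apply: gE; apply: contraTneq hK => ->; rewrite /edgeK -leNgt; lra.
exists ((w - 3) * edgeK l w) => [|a s b t hs ht].
  by rewrite nmulr_rgt0//; lra.
have l1 : l ^+ 2 <= 1 by lra.
exact: le_trans (secular_bottom hs ht l1 wE w0 hK) (ler_norm _).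
Qed.

(* The elimination of the second sublattice breaks down at E^2 = l^2, which lies
   inside a band: there one perturbs E. *)
Lemma band2_perturb l E e : 0 < e -> l ^+ 2 <= 1 / 400 -> l != 0 -> band2 l E ->
  exists E', [/\ (E' - E) ^+ 2 <= e, band2 l E' & E' ^+ 2 != l ^+ 2].
Proof.
move=> e0 le ln0 hb; have [El|El] := eqVneq (E ^+ 2) (l ^+ 2); last first.
  by exists E; rewrite subrr expr0n; split=> //; exact: ltW.
have l0 : 0 < l ^+ 2 by rewrite exprn_even_gt0.
pose d := Num.min 1 e; have d0 : 0 < d by rewrite lt_min ltr01.
have d1 : d <= 1 by rewrite ge_min lexx.
have de : d <= e by rewrite ge_min lexx orbT.
have dd : d ^+ 2 <= d by rewrite expr2 ler_piMr// ltW.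
(* Enlarging |E| moves w from -1 to slightly above it, where [edgeK] stays nonnegative. *)
exists (E * (1 + d)); split.
- have -> : (E * (1 + d) - E) ^+ 2 = l ^+ 2 * d ^+ 2 by rewrite -El; ring.
  apply: le_trans de; apply: le_trans dd; rewrite ler_piMl ?sqr_ge0//; lra.
- have dq : 0 <= d ^+ 2 by exact: sqr_ge0.
  right; rewrite /shifted exprMn El; set w := _ - 1 - _.
  have p1 : l ^+ 2 * (2 * d + d ^+ 2) <= 1 / 400 * 3.
    by apply: ler_pM => //; lra.
  have p0 : 0 <= l ^+ 2 * (2 * d + d ^+ 2) by apply: mulr_ge0; lra.
  have wE : w = -1 + l ^+ 2 * (2 * d + d ^+ 2) by rewrite /w; ring.
  have w1 : -1 <= w by lra.
  have w2 : w <= - 1 / 2 by lra.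
  clearbody w; split; first by lra.
    rewrite /edgeK; have : 0 <= (w + 1) * (w - 3) ^+ 2.
      by rewrite mulr_ge0 ?sqr_ge0//; lra.
    have : 0 <= l ^+ 2 * (- w) by apply: mulr_ge0; lra.
    lra.
  by rewrite /edge0; have := sqr_ge0 w; lra.
- rewrite exprMn El -subr_eq0.
  have -> : l ^+ 2 * (1 + d) ^+ 2 - l ^+ 2 = l ^+ 2 * (d * (2 + d)) by ring.
  have d2 : 0 < 2 + d by lra.
  by apply: lt0r_neq0; rewrite mulr_gt0// mulr_gt0.
Qed.

Local Notation op2 l := (schr hop0 hop1 hop2
  (fun u => l * pot2 R (parity u.1.1) (parity u.1.2) u.2)).

Lemma spectrum_pot2_real l E : l ^+ 2 <= 1 / 400 -> l != 0 ->
  spectrum (op2 l) (E%:C)%C <-> band2 l E.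
Proof.
move=> le ln0; split=> [|hb].
  apply: contraPP => nb hs; apply: hs.
  have [El [c0 c00 hc]] := band2_gap le nb.
  set k := ((E + l) ^+ 3 * (E - l)) ^+ 2.
  have k0 : 0 < k.
    rewrite /k exprn_even_gt0//= mulf_neq0//; last first.
      by rewrite subr_eq0; apply: contra El => /eqP->.
    by rewrite expf_neq0// addr_eq0; apply: contra El => /eqP->; rewrite sqrrN.
  apply: (@pot2_resolvent _ l E (k * c0 ^+ 2) El); first by rewrite mulr_gt0// exprn_gt0.
  move=> x y x1 y1; rewrite det_schur_secular// nsq_real exprMn ler_pM2l//.
  rewrite -[leRHS]real_normK ?num_real// ler_sqr ?nnegrE ?(ltW c00)//.
  by apply: hc; [move: x1|move: y1]; rewrite /nsq => h; rewrite -h; ring.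
refine (@hex_spectrum_fiber R (fun c1 c2 t : bool => l * pot2 R c1 c2 t) _ _) => e e0.
have [E' [h1 hb' El]] := band2_perturb e0 le ln0 hb.
have [A /andP[A0 A1] hA] := band2_zero le hb'.
set a := Num.sqrt (1 - A); set s := Num.sqrt A.
have aE : a ^+ 2 = 1 - A by rewrite sqr_sqrtr// subr_ge0.
have sE : s ^+ 2 = A by rewrite sqr_sqrtr.
have x1 : nsq (a +i* s)%C = 1 by rewrite /nsq /= aE sE subrK.
have y1 : nsq (a -i* s)%C = 1 by rewrite /nsq /= sqrrN aE sE subrK.
have hdet : \det (schur_mx (l%:C)%C (E'%:C)%C
    (a +i* s)%C (a +i* s)%C^-1 (a -i* s)%C (a -i* s)%C^-1) = 0.
  rewrite det_schur_secular//=.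
  have -> : a * a + s * - s = 1 - 2 * A by rewrite mulrN -!expr2 aE sE; ring.
  have -> : secular l (E' ^+ 2 - 1 - l ^+ 2) a a (1 - 2 * A) =
     secular_path l (shifted l E') A.
    by rewrite /secular /secular_path aE /shifted; ring.
  by rewrite hA mulr0.
have [phi phi0 hphi] := pot2_kernel El x1 y1 hdet.
exists (E'%:C)%C, (a +i* s)%C, (a -i* s)%C, phi; split=> //.
by rewrite -rmorphB /= nsq_real.
Qed.

Lemma pot2_resolvent_nonreal l z : complex.Im z != 0 ->
  resolvent_set (op2 l) z.
Proof.
have qQ u : `|l * pot2 R (parity u.1.1) (parity u.1.2) u.2| <= `|l|.
  rewrite normrM ler_piMr// /pot2.
  by case: ifP; case: ifP; rewrite ?normrN1 ?normr1.
exact: (resolvent_nonreal hop0K hop1K hop2K qQ).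
Qed.

Lemma spectrum_pot2 l : l ^+ 2 <= 1 / 400 -> l != 0 ->
  spectrum (op2 l) = [set (E%:C)%C | E in band2 l].
Proof.
move=> le ln0; apply/seteqP; split=> z.
  have [z0|z0] := eqVneq (complex.Im z) 0; last first.
    by move=> hs; exfalso; apply: hs; exact: pot2_resolvent_nonreal.
  have -> : z = ((complex.Re z)%:C)%C by case: z z0 => a b /= ->.
  by move=> /spectrum_pot2_real h; exists (complex.Re z) => //; exact: h.
by move=> [E hb <-]; apply/spectrum_pot2_real.
Qed.

End Band.

(** * The (1, 1)-periodic potential *)

Section StaggeredPotential.
Variable R : realType.
Local Notation C := R[i].

Definition pot1 (c1 c2 t : bool) : R := if t then -1 else 1.

(** A (1,1)-periodic potential makes the 8 x 8 fiber commute with the translations of the 2 x 2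
    cell, so the four sign characters [chi] split it into 2 x 2 blocks with off-diagonal entries 1 +
    s1 x + s2 y and its conjugate. Up to sign the block determinant is [den] = |1 + s1 x + s2 y|^2 -
    g, and the square lies in [0, 9]. *)
Lemma staggered_below (lam E : R) : E ^+ 2 < lam ^+ 2 \/ 9 + lam ^+ 2 < E ^+ 2 ->
  exists2 k : R, 0 < k & forall (x y : C) phi, nsq x = 1 -> nsq y = 1 ->
    k * fiber_normsq phi <=
    fiber_normsq (fiber (fun c1 c2 t => ((lam * pot1 c1 c2 t)%:C)%C - (E%:C)%C) x y phi).
Proof.
move=> hE; pose p (c1 c2 t : bool) : C := ((lam * pot1 c1 c2 t)%:C)%C - (E%:C)%C.
pose T : Type := (C * C * (bool -> bool -> bool -> C))%type.
pose P (t : T) : Prop := nsq t.1.1 = 1 /\ nsq t.1.2 = 1.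
pose D (t : T) : R := fiber_normsq (fiber p t.1.1 t.1.2 t.2).
have D0 t : 0 <= D t by exact: le_trans (nsq_ge0 _) (fiber_normsq_ge _ true true true).
have bx : dominated P (fun=> 1) (fun t => t.1.1).
  by exists 1 => // t [-> _]; rewrite mulr1.
have by_ : dominated P (fun=> 1) (fun t => t.1.2).
  by exists 1 => // t [_ ->]; rewrite mulr1.
have bxi : dominated P (fun=> 1) (fun t => t.1.1^-1).
  by exists 1 => // t [x1 _]; rewrite mulr1 -nsq_unit_inv// nsqJ x1.
have byi : dominated P (fun=> 1) (fun t => t.1.2^-1).
  by exists 1 => // t [_ y1]; rewrite mulr1 -nsq_unit_inv// nsqJ y1.
have dh c1 c2 t' : dominated P D (fun t => fiber p t.1.1 t.1.2 t.2 c1 c2 t').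
  by exists 1 => // t _; rewrite mul1r; exact: fiber_normsq_ge.
pose chi (s1 s2 : C) (t : bool) (f : bool -> bool -> bool -> C) : C :=
  f false false t + s1 * f true false t + s2 * f false true t + s1 * s2 * f true true t.
pose g : R := E ^+ 2 - lam ^+ 2.
pose den (s1 s2 : C) (t : T) : C :=
  (1 + s1 * t.1.1 + s2 * t.1.2) * (1 + s1 * t.1.1^-1 + s2 * t.1.2^-1) - (g%:C)%C.
have signP (s : C) : s ^+ 2 = 1 -> (s^*)%C = s /\ nsq s = 1.
  move/eqP; rewrite sqrf_eq1 => /orP[] /eqP->.
    by rewrite rmorph1 /nsq /= expr0n addr0 expr1n.
  by rewrite rmorphN rmorph1 nsqN /nsq /= expr0n addr0 expr1n.
have denE s1 s2 t : s1 ^+ 2 = 1 -> s2 ^+ 2 = 1 -> P t ->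
    den s1 s2 t = ((nsq (1 + s1 * t.1.1 + s2 * t.1.2) - g)%:C)%C.
  move=> h1 h2 [x1 y1]; rewrite rmorphB /= nsqE /den -!nsq_unit_inv//.
  by rewrite !(rmorphD, rmorphM, rmorph1) /= (signP _ h1).1 (signP _ h2).1.
(* The squared distance from [g] to [0, 9]: [g] is negative in the first case and above 9 in the
   second. *)
have [c0 c00 hc0] : exists2 c0 : R, 0 < c0 & forall n : R, 0 <= n -> n <= 9 -> c0 <= (n - g) ^+ 2.
  case: hE => hE.
    exists (g ^+ 2) => [|n n0 _].
      by rewrite exprn_even_gt0//= /g subr_eq0 lt_eqF.
    have : 0 <= n * (n - 2 * g) by apply: mulr_ge0 => //; rewrite /g; lra.
    lra.
  exists ((g - 9) ^+ 2) => [|n _ n9].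
    by rewrite exprn_even_gt0//= gt_eqF// /g; lra.
  have : 0 <= (9 - n) * (2 * g - 9 - n) by apply: mulr_ge0; rewrite /g; lra.
  lra.
have bden s1 s2 : s1 ^+ 2 = 1 -> s2 ^+ 2 = 1 ->
    dominated P (fun=> 1) (fun t => (den s1 s2 t)^-1) /\ forall t, P t -> den s1 s2 t != 0.
  move=> h1 h2.
  have low t : P t -> c0 <= nsq (den s1 s2 t).
    move=> Pt; rewrite denE// nsq_real; apply: hc0; first exact: nsq_ge0.
    case: Pt => x1 y1; apply: le_trans (nsqD3 _ _ _) _.
    rewrite !nsqM x1 y1 (signP _ h1).2 (signP _ h2).2 /nsq /= expr0n addr0 expr1n; lra.
  have d0 t : P t -> den s1 s2 t != 0.
    by move=> Pt; rewrite -nsq_eq0 gt_eqF// (lt_le_trans c00)// low.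
  split=> //; exists c0^-1 => [|t Pt]; first by rewrite invr_ge0 ltW.
  have n0 : 0 < nsq (den s1 s2 t) by rewrite (lt_le_trans c00)// low.
  have -> : nsq ((den s1 s2 t)^-1) = (nsq (den s1 s2 t))^-1.
    apply: (mulfI (lt0r_neq0 n0)); rewrite -nsqM divff ?d0// divff ?lt0r_neq0//.
    by rewrite /nsq /= expr0n addr0 expr1n.
  by rewrite mulr1 lef_pV2 ?posrE// low.
have dchi s1 s2 t' : s1 ^+ 2 = 1 -> s2 ^+ 2 = 1 ->
    dominated P D (fun t => chi s1 s2 t' t.2).
  move=> h1 h2; have [bd d0] := bden s1 s2 h1 h2.
  pose l : C := (lam%:C)%C; pose e : C := (E%:C)%C.
  pose F t := fiber p t.1.1 t.1.2 t.2.
  have gE : (g%:C)%C = e ^+ 2 - l ^+ 2 by rewrite /g rmorphB !rmorphXn.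
  have pE c1 c2 b : p c1 c2 b = (if b then - l else l) - e.
    by rewrite /p /pot1 /l; case: b; rewrite ?mulr1 ?mulrN1 ?rmorphN.
  case: t'.
    apply: (dominated_eq (f := fun t => (den s1 s2 t)^-1 *
      ((1 + s1 * t.1.1^-1 + s2 * t.1.2^-1) * (F t false false false + s1 * F t true false false
        + s2 * F t false true false + s1 * s2 * F t true true false)
       - (l - e) * (F t false false true + s1 * F t true false true
        + s2 * F t false true true + s1 * s2 * F t true true true)))).
      move=> t Pt; apply: (mulfI (d0 t Pt)); rewrite mulrA divff ?d0// mul1r.
      case: Pt => x1 y1; have x0 := nsq_unit_neq0 x1; have y0 := nsq_unit_neq0 y1.
      rewrite /den gE /F /fiber /= !pE /chi.
      by field: h1 h2; rewrite x0 y0.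
    apply: dominatedM bd _.
    dominated_rec ltac:(fun _ => first [exact: bx|exact: by_|exact: bxi|exact: byi|exact: dh]).
  apply: (dominated_eq (f := fun t => (den s1 s2 t)^-1 *
    ((l + e) * (F t false false false + s1 * F t true false false
      + s2 * F t false true false + s1 * s2 * F t true true false)
     + (1 + s1 * t.1.1 + s2 * t.1.2) * (F t false false true + s1 * F t true false true
      + s2 * F t false true true + s1 * s2 * F t true true true)))).
    move=> t Pt; apply: (mulfI (d0 t Pt)); rewrite mulrA divff ?d0// mul1r.
    case: Pt => x1 y1; have x0 := nsq_unit_neq0 x1; have y0 := nsq_unit_neq0 y1.
    rewrite /den gE /F /fiber /= !pE /chi.
    by field: h1 h2; rewrite x0 y0.
  apply: dominatedM bd _.
  dominated_rec ltac:(fun _ => first [exact: bx|exact: by_|exact: bxi|exact: byi|exact: dh]).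
have dAll c1 c2 t' : dominated P D (fun t => t.2 c1 c2 t').
  pose sg (b : bool) : C := if b then -1 else 1.
  have q1 : (1 : C) ^+ 2 = 1 by rewrite expr1n.
  have q2 : (-1 : C) ^+ 2 = 1 by rewrite sqrrN expr1n.
  have d1 := dchi 1 1 t' q1 q1; have d2 := dchi (-1) 1 t' q2 q1.
  have d3 := dchi 1 (-1) t' q1 q2; have d4 := dchi (-1) (-1) t' q2 q2.
  (* Inversion of the character transform on the four classes. *)
  apply: (dominated_eq (f := fun t => 4^-1 * (chi 1 1 t' t.2 + sg c1 * chi (-1) 1 t' t.2
     + sg c2 * chi 1 (-1) t' t.2 + sg c1 * sg c2 * chi (-1) (-1) t' t.2))).
    by move=> t _; rewrite /chi /sg; case: c1 c2 => [] []; field.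
  dominated_rec ltac:(fun _ => first [exact: d1|exact: d2|exact: d3|exact: d4]).
exact: (dominated_fiber_below dAll).
Qed.

Definition band1 (lam E : R) : Prop := lam ^+ 2 <= E ^+ 2 <= 9 + lam ^+ 2.

Local Notation op1 lam := (schr hop0 hop1 hop2
  (fun u => lam * pot1 (parity u.1.1) (parity u.1.2) u.2)).

Lemma staggered_kernel (lam E : R) : band1 lam E ->
  exists x y phi, [/\ nsq x = 1, nsq y = 1, (exists c1 c2 t, phi c1 c2 t != 0) &
    forall c1 c2 t, fiber (fun c1 c2 t => ((lam * pot1 c1 c2 t)%:C)%C - (E%:C)%C)
      x y phi c1 c2 t = 0].
Proof.
move=> /andP[h1 h2]; set r := Num.sqrt (E ^+ 2 - lam ^+ 2).
have r0 : 0 <= r by exact: sqrtr_ge0.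
have rE : r ^+ 2 = E ^+ 2 - lam ^+ 2 by rewrite sqr_sqrtr// subr_ge0.
have r3 : r <= 3.
  by rewrite -[leRHS](ger0_norm (ler0n R 3)) -sqrtr_sqr; apply: ler_wsqrtr; lra.
(* With y the conjugate of x, 1 + x + y = 1 + 2a takes the value [r]. A function constant over the
   cells then reduces the fiber to a real 2 x 2 system. *)
pose a := (r - 1) / 2; pose s := Num.sqrt (1 - a ^+ 2).
have sE : s ^+ 2 = 1 - a ^+ 2.
  rewrite sqr_sqrtr//.
  have : 0 <= (3 - r) * (r + 1) by apply: mulr_ge0; lra.
  by rewrite /a; lra.
have x1 : nsq (a +i* s)%C = 1 by rewrite /nsq /= sE; ring.
have y1 : nsq (a -i* s)%C = 1 by rewrite /nsq /= sqrrN sE; ring.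
have [u [v [uv0 hA hB]]] : exists u v : R, [/\ (u != 0) || (v != 0),
    r * v + (lam - E) * u = 0 & r * u - (lam + E) * v = 0].
  have [rn|rn] := eqVneq r 0; last first.
    exists r, (E - lam); rewrite rn; split=> //; first by ring.
    have -> : r * r - (lam + E) * (E - lam) = r ^+ 2 - (E ^+ 2 - lam ^+ 2) by ring.
    by rewrite rE subrr.
  move/eqP: rE; rewrite rn expr0n /= eq_sym subr_sqr mulf_eq0 => /orP[|] /eqP h.
    by exists 1, 0; rewrite oner_eq0; split=> //; lra.
  by exists 0, 1; rewrite oner_eq0 orbT; split=> //; lra.
exists (a +i* s)%C, (a -i* s)%C, (fun _ _ t => ((if t then v else u)%:C)%C); split=> //.
  case/orP: uv0 => h; [exists true, true, false|exists true, true, true];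
    by rewrite -nsq_eq0 nsq_real sqrf_eq0.
have xE : (a +i* s)%C + (a -i* s)%C = ((r - 1)%:C)%C :> R[i].
  by apply/eqP; rewrite eq_complex /= subrr eqxx andbT /a; apply/eqP; field.
have xi : ((a +i* s)%C)^-1 = (a -i* s)%C :> R[i] by rewrite -nsq_unit_inv.
have yi : ((a -i* s)%C)^-1 = (a +i* s)%C :> R[i].
  by rewrite -nsq_unit_inv//=; apply/eqP; rewrite eq_complex /= opprK !eqxx.
move=> c1 c2 t; rewrite /fiber xi yi.
have -> (k : R[i]) (z x y : R[i]) : z + x * z + y * z + k = (1 + (x + y)) * z + k by ring.
case: t; rewrite /= ?xE ?[(a -i* s)%C + _]addrC ?xE -(rmorph1 (real_complex R)).
  rewrite -!(rmorphD, rmorphB, rmorphM) /= -[RHS](rmorph0 (real_complex R)) -hB /pot1.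
  by congr ((_)%:C)%C; ring.
rewrite -!(rmorphD, rmorphB, rmorphM) /= -[RHS](rmorph0 (real_complex R)) -hA /pot1.
by congr ((_)%:C)%C; ring.
Qed.

Lemma spectrum_pot1 (lam : R) :
  spectrum (op1 lam) = [set (E%:C)%C | E in band1 lam].
Proof.
have qQ u : `|lam * pot1 (parity u.1.1) (parity u.1.2) u.2| <= `|lam|.
  by rewrite normrM ler_piMr// /pot1; case: ifP; rewrite ?normrN1 ?normr1.
apply/seteqP; split=> z.
  have [z0|z0] := eqVneq (complex.Im z) 0; last first.
    move=> hs; exfalso; apply: hs.
    exact: (resolvent_nonreal hop0K hop1K hop2K qQ).
  have -> : z = ((complex.Re z)%:C)%C by case: z z0 => a b /= ->.
  set E := complex.Re z => hs; exists E => //; rewrite /band1.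
  have [//|hE] := boolP (lam ^+ 2 <= E ^+ 2 <= 9 + lam ^+ 2); exfalso; apply: hs.
  have {}hE : E ^+ 2 < lam ^+ 2 \/ 9 + lam ^+ 2 < E ^+ 2.
    by move: hE; rewrite negb_and -!ltNge => /orP[]; [left|right].
  have [k k0 hk] := staggered_below hE.
  exact: (@resolvent_fiber _ (fun c1 c2 t => lam * pot1 c1 c2 t) _ k k0 hk).
move=> [E hb <-].
refine (@hex_spectrum_fiber R (fun c1 c2 t => lam * pot1 c1 c2 t) _ _) => e e0.
have [x [y [phi [x1 y1 phi0 hphi]]]] := staggered_kernel hb.
exists (E%:C)%C, x, y, phi; split=> //.
by rewrite subrr nsq0 ltW.
Qed.

End StaggeredPotential.

(** * Counting components *)

Section RealComponents.
Variable R : realType.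
Local Notation C := (R[i] : numFieldType).

(** Radii of balls in [R[i]] are themselves complex; positivity forces them to be real. *)
Lemma normc_pos (e : R[i]) : 0 < e -> exists2 r : R, 0 < r & e = (r%:C)%C.
Proof.
case: e => a b; rewrite ltcE /= => /andP[/eqP-> a0].
by exists a.
Qed.

Lemma continuous_real_complex : continuous (fun x : R => (x%:C)%C : C).
Proof.
move=> x; apply/cvgrPdist_lt => e /normc_pos[r r0 ->].
near=> y.
rewrite -rmorphB /= normc_def /= expr0n addr0 sqrtr_sqr ltcR.
near: y; exact: cvgr_dist_lt.
Unshelve. all: by end_near.
Qed.

Lemma continuous_Re : continuous (fun z : C => complex.Re (z : R[i])).
Proof.
move=> x U /nbhs_ballP[e /= e0 hU].
have e1 : 0 < (e%:C)%C :> R[i] by rewrite ltcR.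
exists (e%:C)%C => //= y xy; apply: hU; rewrite /ball /=.
rewrite -ltcR; apply: le_lt_trans xy.
have -> : complex.Re x - complex.Re y = complex.Re (x - y : R[i]).
  by case: (x) (y) => ? ? [].
exact: normc_ge_Re.
Qed.

(** A connected subset of the embedded set projects under the real part to an interval, which cannot
    jump over a point outside [B]; so components do not mix labels, and each label class is convex,
    hence connected. *)
Lemma card_real_components (B : set R) (n : nat) (idx : R -> nat) :
  (forall x, B x -> (idx x < n)%N) ->
  (forall i, (i < n)%N -> exists2 x, B x & idx x = i) ->
  (forall x y z, B x -> B y -> idx x = idx y -> x <= z <= y ->
     B z /\ idx z = idx x) ->
  (forall x y, B x -> B y -> (idx x < idx y)%N \/ (idx y < idx x)%N ->
     exists2 z, ~ B z & (x <= z <= y) \/ (y <= z <= x)) ->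
  connected_components [set (E%:C)%C | E in B] #= `I_n.
Proof.
move=> idxn idxS conv cut.
pose piece (i : nat) : set R := [set x | B x /\ idx x = i].
pose comp (i : nat) : set C := [set (E%:C)%C | E in piece i].
have compE x : B x ->
    @connected_component C [set (E%:C)%C | E in B] (x%:C)%C = comp (idx x).
  move=> Bx; apply/seteqP; split.
    move=> y [U [Ux UA Uc] Uy].
    have [E BE Ey] := UA _ Uy; exists E => //; split=> //.
    apply: contrapT => /eqP; rewrite neq_ltn orbC => /orP h.
    have [z nz hz] := cut _ _ Bx BE h.
    have Ic : is_interval ((fun z : C => complex.Re (z : R[i])) @` U).
      apply/connected_intervalP; apply: connected_continuous_connected => //.
      by apply: continuous_subspaceT; exact: continuous_Re.
    have ux : ((fun z : C => complex.Re (z : R[i])) @` U) x by exists (x%:C)%C.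
    have uE : ((fun z : C => complex.Re (z : R[i])) @` U) E by exists y => //; rewrite -Ey.
    have [w Uw wz] : ((fun z : C => complex.Re (z : R[i])) @` U) z.
      by case: hz => hz; [exact: (Ic _ _ ux uE)|exact: (Ic _ _ uE ux)].
    have [F BF Fw] := UA _ Uw; apply: nz.
    by rewrite -wz -Fw.
  apply: connected_component_max => //.
  - by exists x.
  - by move=> _ [y [By _] <-]; exists y.
  apply: connected_continuous_connected.
    apply/connected_intervalP => y z [By iy] [Bz iz] w hw.
    have [|h1 h2] := conv y z w By Bz _ hw; first by rewrite iy iz.
    by split=> //; rewrite h2.
  by apply: continuous_subspaceT; exact: continuous_real_complex.
have -> : connected_components [set (E%:C)%C | E in B] = comp @` `I_n.
  apply/seteqP; split=> [_ [_ [x Bx <-] <-]|_ [i /= hi <-]].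
    by exists (idx x); [exact: idxn|rewrite compE].
  have [x Bx <-] := idxS i hi; exists (x%:C)%C; first by exists x.
  by rewrite compE.
apply: inj_card_eq => i j; rewrite !inE => hi hj E.
have [x Bx xi] := idxS i hi.
have : comp i (x%:C)%C by exists x.
by rewrite E => -[y [By <-] /complexI yx]; rewrite -xi yx.
Qed.

End RealComponents.

Section Counting.
Variable R : realType.

Lemma band1_components (l : R) : 0 < l ->
  connected_components [set (E%:C)%C | E in band1 l] #= `I_2.
Proof.
move=> l0; have l2 : 0 < l ^+ 2 by rewrite exprn_gt0.
apply: (@card_real_components _ _ _ (fun E : R => ((0 < E)%R : nat))).
- by move=> x _; case: (0 < x).
- move=> [|[|i]] // _.
    exists (- l); first by rewrite /band1 sqrrN lexx; lra.
    by rewrite oppr_gt0 ltNge ltW.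
  by exists l; rewrite ?l0// /band1 lexx; lra.
- move=> x y z /andP[x1 x2] /andP[y1 y2] + /andP[xz zy] /=.
  rewrite /band1; case: (ltP 0 x) => hx; case: (ltP 0 y) => hy // _; split.
  + by apply/andP; split; [apply: le_trans x1 _|apply: le_trans y2];
      rewrite ler_sqr ?nnegrE//; lra.
  + by rewrite (lt_le_trans hx xz).
  + by apply/andP; split; [apply: le_trans y1 _|apply: le_trans x2];
      rewrite -(sqrrN z) -?(sqrrN x) -?(sqrrN y) ler_sqr ?nnegrE//; lra.
  + by rewrite ltNge (le_trans zy hy).
- move=> x y _ _ h; exists 0; first by apply/negP; rewrite expr0n /= negb_and -ltNge l2.
  move: h; have [hx|] := boolP (0 < x); have [hy|] := boolP (0 < y) => //=.
  - by case.
  - by rewrite -leNgt => hy _; right; rewrite hy ltW.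
  - by rewrite -leNgt => hx _; left; rewrite hx ltW.
  - by move=> _ _ [].
Qed.

(** [band2] depends on the energy only through its square, so convexity is needed on each side of 1.
    Beyond 1 one has w > -l^2, where a negative w would violate [edge0 >= 0], so only the first
    alternative remains; below 1, w is negative and only the second does. *)
Lemma band2_between (l x y z : R) : l ^+ 2 <= 1 / 400 ->
  band2 l x -> band2 l y -> x ^+ 2 <= z ^+ 2 <= y ^+ 2 ->
  1 < x ^+ 2 \/ y ^+ 2 < 1 -> band2 l z.
Proof.
move=> le; have l0 := sqr_ge0 l; rewrite /band2 /shifted.
move: (x ^+ 2) (y ^+ 2) (z ^+ 2) => X Y Z.
have E1 (w : R) : w < 0 -> - l ^+ 2 < w -> 0 <= edge0 l w -> False.
  move=> w0 w1; rewrite /edge0; have : 0 <= (- w) * (w + l ^+ 2) by apply: mulr_ge0; lra.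
  have : 0 <= (1 / 400 - l ^+ 2) * (- w) by apply: mulr_ge0; lra.
  lra.
set wx := X - 1 - _; set wy := Y - 1 - _; set wz := Z - 1 - _.
move=> hx hy /andP[xz zy] hs.
have xz' : wx <= wz by rewrite /wx /wz; lra.
have zy' : wz <= wy by rewrite /wy /wz; lra.
case: hs => hs.
  have w1 : - l ^+ 2 < wx by rewrite /wx; lra.
  have [wx0 _] : 0 <= wx /\ edge0 l wx <= 0.
    by case: hx => // -[h1 h2 h3]; case: (E1 _ h1 w1 h3).
  have {hy}[wy0 hy] : 0 <= wy /\ edge0 l wy <= 0.
    by case: hy => // -[h1 h2 h3]; lra.
  left; split; first by lra.
  move: hy; rewrite /edge0; clearbody wx wy wz.
  have [w8|w8] := lerP wz 8.
    have : 0 <= wz * (8 - wz) by apply: mulr_ge0; lra.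
    lra.
  have : 0 <= (wy - wz) * (wy + wz - 8) by apply: mulr_ge0; lra.
  lra.
have w1 : wy < 0 by rewrite /wy; lra.
have {hx}[wx0 hK _] : [/\ wx < 0, 0 <= edgeK l wx & 0 <= edge0 l wx].
  by case: hx => // -[h1 h2]; lra.
have {hy}[_ _ he] : [/\ wy < 0, 0 <= edgeK l wy & 0 <= edge0 l wy].
  by case: hy => // -[h1 h2]; lra.
clearbody wx wy wz; right; split; first by lra.
  apply: le_trans hK _; rewrite -subr_ge0.
  (* On the negative axis [edgeK] increases and [edge0] decreases, so each condition is inherited
     from one endpoint. *)
  have -> : edgeK l wz - edgeK l wx = (wz - wx) *
    (wz ^+ 2 + wx ^+ 2 + (- wz) * (- wx) + 5 * (- wz - wx) + (3 - 12 * l ^+ 2)).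
    by rewrite /edgeK; ring.
  apply: mulr_ge0; first by lra.
  have := sqr_ge0 wz; have := sqr_ge0 wx.
  have : 0 <= (- wz) * (- wx) by apply: mulr_ge0; lra.
  lra.
apply: le_trans he _; rewrite -subr_ge0.
have -> : edge0 l wz - edge0 l wy = (wy - wz) * (8 - wz - wy).
  by rewrite /edge0; ring.
by apply: mulr_ge0; lra.
Qed.

(** E^2 = 1 gives w = -l^2 and [edge0] = l^4 - 4 l^2 < 0; E = 0 gives w = -1 - l^2 and [edgeK] =
    -l^2 (2 - l^2)^2 < 0. *)
Lemma band2_cut (l E : R) : l ^+ 2 <= 1 / 400 -> 0 < l ^+ 2 ->
  E ^+ 2 = 1 \/ E ^+ 2 = 0 -> ~ band2 l E.
Proof.
move=> le l0 h; have h2 := sqr_ge0 (l ^+ 2); rewrite /band2 /shifted /edge0 /edgeK.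
have h3 : 0 <= (l ^+ 2) ^+ 2 * l ^+ 2 by rewrite mulr_ge0// ltW.
have h4 : (l ^+ 2) ^+ 2 <= 1 / 400 * l ^+ 2.
  by rewrite expr2 ler_wpM2r// ltW.
by case: h => ->; [case=> [[h _]|[h _ h']]|case=> [[h _]|[_ h h']]]; lra.
Qed.

Lemma band2_components (l : R) : 0 < l < 1 / 20 ->
  connected_components [set (E%:C)%C | E in band2 l] #= `I_4.
Proof.
move=> /andP[l0 l1].
have le : l ^+ 2 <= 1 / 400.
  have : 0 <= (1 / 20 - l) * (1 / 20 + l) by apply: mulr_ge0; lra.
  lra.
have l2 : 0 < l ^+ 2 by rewrite exprn_gt0.
have l4 := sqr_ge0 (l ^+ 2).
have l4' : (l ^+ 2) ^+ 2 <= 1 / 400 * l ^+ 2 by rewrite expr2 ler_wpM2r// ltW.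
have cut1 : ~ band2 l 1 by apply: band2_cut => //; left; rewrite expr1n.
have cutN1 : ~ band2 l (-1) by apply: band2_cut => //; left; rewrite sqrrN expr1n.
have cut0 : ~ band2 l 0 by apply: band2_cut => //; right; rewrite expr0n.
have outer (E : R) : E ^+ 2 = 9 -> band2 l E.
  by move=> h; left; rewrite /shifted h /edge0; split; lra.
have inner (E : R) : E ^+ 2 = 1 / 4 -> band2 l E.
  move=> h; right; rewrite /shifted h /edge0 /edgeK.
  have : 0 <= (1 / 4 - l ^+ 2) * (15 / 4 + l ^+ 2) ^+ 2.
    by apply: mulr_ge0; [lra|exact: sqr_ge0].
  by move=> h'; split; lra.
(* The label counts how many of the gap energies -1, 0, 1 lie below E. Each comparison is monotone
   in E, so equal counts force the three comparisons to agree. *)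
apply: (@card_real_components _ _ _
  (fun E : R => ((-1 < E)%R + (0 < E)%R + (1 < E)%R)%N)).
- by move=> x _; do 3!case: (_ < x).
- move=> [|[|[|[|i]]]] // _.
  + exists (-3); first by apply: outer; ring.
    by do 3!(rewrite (_ : (_ < -3 :> R) = false); last by apply/negbTE; rewrite -leNgt; lra).
  + exists (- (1 / 2)); first by apply: inner; field.
    rewrite (_ : (-1 < - (1 / 2) :> R) = true); last by lra.
    by do 2!(rewrite (_ : (_ < - (1 / 2) :> R) = false); last by apply/negbTE; rewrite -leNgt; lra).
  + exists (1 / 2); first by apply: inner; field.
    rewrite (_ : (-1 < 1 / 2 :> R) = true); last by lra.
    rewrite (_ : (0 < 1 / 2 :> R) = true); last by lra.
    by rewrite (_ : (1 < 1 / 2 :> R) = false); last by apply/negbTE; rewrite -leNgt; lra.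
  + exists 3; first by apply: outer; ring.
    by do 3!(rewrite (_ : (_ < 3 :> R) = true); last by lra).
- have sq (u v : R) : 0 <= u -> u <= v -> u ^+ 2 <= v ^+ 2.
    by move=> u0 uv; rewrite ler_sqr ?nnegrE//; lra.
  have sqN (u v : R) : v <= 0 -> u <= v -> v ^+ 2 <= u ^+ 2.
    by move=> v0 uv; rewrite -(sqrrN u) -(sqrrN v); apply: sq; lra.
  have sq1 (u : R) : 1 < u -> 1 < u ^+ 2 by move=> h; rewrite exprn_egt1.
  have sq1' (u : R) : -1 < u -> u < 1 -> u ^+ 2 < 1.
    move=> h1 h2; have : 0 < (1 - u) * (1 + u) by apply: mulr_gt0; lra.
    lra.
  move=> x y z hx hy ixy /andP[xz zy]; have xy := le_trans xz zy.
  split; last first.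
    have mono (u v : R) : u <= v -> ((-1 < u)%R + (0 < u)%R + (1 < u)%R <=
        (-1 < v)%R + (0 < v)%R + (1 < v)%R)%N.
      move=> uv; have m c : ((c < u)%R <= (c < v)%R)%N.
        by have [h|//] := boolP (c < u); rewrite (lt_le_trans h uv).
      by rewrite !leq_add.
    by apply/eqP; rewrite eqn_leq {1}ixy !mono.
  have imp c : c < x -> c < y by move=> h; exact: lt_le_trans xy.
  have [eN1 e0 e1] : [/\ (-1 < x) = (-1 < y), (0 < x) = (0 < y) & (1 < x) = (1 < y)].
    move: ixy (imp (-1)) (imp 0) (imp 1) => /=.
    case: (-1 < x); case: (-1 < y); case: (0 < x); case: (0 < y);
      case: (1 < x); case: (1 < y) => // i1 i2 i3 i4;
      by [have := i2 isT|have := i3 isT|have := i4 isT].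
  have lt_cut c : ~ band2 l c -> (c < x) = (c < y) -> ~~ (c < x) -> y < c.
    move=> nc cE hc; have : y <= c by rewrite leNgt -cE.
    by rewrite le_eqVlt => /orP[/eqP yc|//]; case: nc; rewrite -yc.
  have [h1|/(lt_cut _ cut1 e1) h1] := boolP (1 < x).
    apply: (band2_between le hx hy); last by left; exact: sq1.
    by apply/andP; split; apply: sq => //; lra.
  have [h0|/(lt_cut _ cut0 e0) h0] := boolP (0 < x).
    apply: (band2_between le hx hy); last by right; apply: sq1' => //; lra.
    by apply/andP; split; apply: sq => //; lra.
  have sqs : y ^+ 2 <= z ^+ 2 <= x ^+ 2.
    by apply/andP; split; apply: sqN => //; lra.
  have [hN|/(lt_cut _ cutN1 eN1) hN] := boolP (-1 < x).
    by apply: (band2_between le hy hx sqs); right; apply: sq1' => //; lra.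
  by apply: (band2_between le hy hx sqs); left; rewrite -sqrrN sq1//; lra.
- move=> x y _ _ /= h.
  have H (c : R) : ~ band2 l c -> (c < x) != (c < y) ->
      exists2 z, ~ band2 l z & x <= z <= y \/ y <= z <= x.
    move=> nc; have [hx|] := boolP (c < x); have [hy|] := boolP (c < y) => //=.
      by rewrite -leNgt => hy _; exists c => //; right; rewrite hy ltW.
    by rewrite -leNgt => hx _; exists c => //; left; rewrite hx ltW.
  have [e1|n1] := eqVneq (-1 < x) (-1 < y); last exact: H n1.
  have [e2|n2] := eqVneq (0 < x) (0 < y); last exact: H n2.
  have [e3|n3] := eqVneq (1 < x) (1 < y); last exact: H n3.
  by move: h; rewrite e1 e2 e3 ltnn => -[].
Qed.

Lemma hex_potential (f : site -> R) : exists Q : Vhex R -> R,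
  forall u, Q (hex_vertex R u) = f u.
Proof.
have [g gP] := choice (@hex_vertex_surj R).
by exists (f \o g) => u; congr f; apply: (@hex_vertex_inj R); rewrite gP.
Qed.

Lemma hex_potential_periodic (p1 p2 : nat) (Q : Vhex R -> R) (f : site -> R) :
  (forall u, Q (hex_vertex R u) = f u) ->
  (forall n m t, f (n + p1%:Z, m, t) = f (n, m, t)) ->
  (forall n m t, f (n, m + p2%:Z, t) = f (n, m, t)) -> hex_periodic p1 p2 Q.
Proof.
move=> Qf f1 f2; split=> u v.
  have [[[n m] t] <-] := hex_vertex_surj u; rewrite Qf -f1 => E.
  rewrite -Qf; congr Q; apply: val_inj; rewrite /= E /= /hex_point /=.
  by rewrite mulrzDr -addrA [hex_bm _ *~ _ + _]addrC addrA addrA -pmulrn.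
have [[[n m] t] <-] := hex_vertex_surj u; rewrite Qf -f2 => E.
rewrite -Qf; congr Q; apply: val_inj; rewrite /= E /= /hex_point /=.
by rewrite mulrzDr addrA -pmulrn.
Qed.

End Counting.

Theorem theorem1p4 (R : realType) :
  (exists Q1 : Vhex R -> R,
     hex_periodic 1 1 Q1 /\
     forall lambda : R, 0 < lambda ->
       connected_components
         (spectrum (hex_schrodinger (fun u => lambda * Q1 u))) #= `I_2) /\
  (exists Q2 : Vhex R -> R,
     hex_periodic 2 2 Q2 /\
     exists2 lambda0 : R, 0 < lambda0 &
     forall lambda : R, 0 < lambda < lambda0 ->
       connected_components
         (spectrum (hex_schrodinger (fun u => lambda * Q2 u))) #= `I_4).
Proof.
split.
  have [Q QP] := hex_potential
    (fun u => pot1 R (parity u.1.1) (parity u.1.2) u.2).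
  exists Q; split; first exact: (hex_potential_periodic QP).
  move=> l l0; rewrite hex_spectrum.
  have -> : (fun u => l * Q u) \o hex_vertex R =
      fun u => l * pot1 R (parity u.1.1) (parity u.1.2) u.2.
    by apply/funext => u; rewrite /= QP.
  by rewrite spectrum_pot1; exact: band1_components.
have [Q QP] := hex_potential (fun u => pot2 R (parity u.1.1) (parity u.1.2) u.2).
have parity2 n : parity (n + 2%:Z) = parity n by rewrite /parity; lia.
exists Q; split.
  by apply: (hex_potential_periodic QP) => n m t /=; rewrite parity2.
(* This is the smallness [l ^+ 2 <= 1 / 400] assumed in the band estimates. *)
exists (1 / 20) => [|l /[dup] l01 /andP[l0 l1]]; first by lra.
have -> : spectrum (hex_schrodinger (fun u => l * Q u)) =
    [set (E%:C)%C | E in band2 l].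
  rewrite hex_spectrum.
  have -> : (fun u => l * Q u) \o hex_vertex R =
      fun u => l * pot2 R (parity u.1.1) (parity u.1.2) u.2.
    by apply/funext => u; rewrite /= QP.
  apply: spectrum_pot2; last by rewrite gt_eqF.
  have : 0 <= (1 / 20 - l) * (1 / 20 + l) by apply: mulr_ge0; lra.
  lra.
exact: band2_components.
Qed.
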